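(* $$p_a^+(\mathbb{Z}^n)\le\frac{\sqrt{2}}{n}\cdot(1+o(1))\quad\text{as } n\to\infty.$$
   Context: $\mathbb{Z}^n$ is the undirected nearest-neighbour hypercubic lattice. For an infinite, connected, locally finite graph $G=(V,E)$, a bond percolation model is a probability measure $\mathrm{P}$ on $\{0,1\}^E$ with the product $\sigma$-algebra ($\omega(e)=1$: $e$ open). $\mathrm{P}$ is 1-independent if the edge statuses in $F_1$ are independent of those in $F_2$ whenever $F_1,F_2\subseteq E$ are disjoint and at graph distance at least $1$ (i.e. no edge of $F_1$ shares a vertex with an edge of $F_2$). $\mathrm{P}$ is positively associated if $\mathrm{P}[A_1\cap A_2]\ge\mathrm{P}[A_1]\mathrm{P}[A_2]$ for all events $A_1,A_2$ increasing in $\omega$ (coordinatewise order). $\mathrm{P}$ percolates if with positive probability the subgraph of open edges contains an infinite connected component. $\mathcal{P}_a(G,p)$ is the set of positively associated, 1-independent bond percolation models $\mathrm{P}$ on $G$ with $\mathrm{P}[\omega(e)=1]\ge p$ for all $e\in E$, and $$p_a^+(G):=\sup\{p:\ \exists\,\mathrm{P}\in\mathcal{P}_a(G,p)\text{ that does not percolate}\}.$$ *)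

(* Defs.v *)
From HB Require Import structures.
From mathcomp Require Import all_boot all_order all_algebra.
From mathcomp Require Import all_classical all_reals all_analysis.

Set Implicit Arguments.
Unset Strict Implicit.
Unset Printing Implicit Defensive.

Import Order.TTheory GRing.Theory Num.Theory.
Import numFieldNormedType.Exports.

Local Open Scope classical_set_scope.
Local Open Scope ring_scope.

Record sgraph := SGraph {
  vertex :> choiceType;
  adj : rel vertex;
  adj_sym : symmetric adj;
  adj_irr : irreflexive adj }.

(* Undirected edges, as two-element sets of adjacent vertices. *)
Definition edge (G : sgraph) : Type :=
  {e : set G | exists x y : G, adj x y /\ e = [set x; y]}.

Definition cylinders (G : sgraph) (F : set (edge G)) :
    set (set (edge G -> bool)) :=
  [set [set w : edge G -> bool | w e] | e in F].

(* {0,1}^E with its product sigma-algebra. *)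
Notation config G := (g_sigma_algebraType (cylinders [set: edge G])).

(* The sigma-algebra generated by the statuses of the edges in F. *)
Definition status_algebra (G : sgraph) (F : set (edge G)) :
    set (set (edge G -> bool)) :=
  <<s cylinders F >>.

Definition endpoints (G : sgraph) (F : set (edge G)) : set G :=
  \bigcup_(e in F) sval e.

(* The edge sets F1 and F2 may be infinite. Graph distance at least 1 between
   them means that no vertex is an endpoint of an edge in each. *)
Definition one_independent (R : realType) (G : sgraph)
    (P : probability (config G) R) : Prop :=
  forall F1 F2 : set (edge G),
    F1 `&` F2 = set0 -> endpoints F1 `&` endpoints F2 = set0 ->
    forall A1 A2, status_algebra F1 A1 -> status_algebra F2 A2 ->
      P (A1 `&` A2) = (P A1 * P A2)%E.

Definition increasing_event (G : sgraph) (A : set (config G)) : Prop :=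
  measurable A /\
  forall w w' : edge G -> bool, (forall e, w e -> w' e) -> A w -> A w'.

Definition positively_associated (R : realType) (G : sgraph)
    (P : probability (config G) R) : Prop :=
  forall A1 A2 : set (config G),
    increasing_event A1 -> increasing_event A2 ->
    (P A1 * P A2 <= P (A1 `&` A2))%E.

Definition open_adj (G : sgraph) (w : edge G -> bool) : rel G :=
  [rel x y | `[< exists e : edge G, sval e = [set x; y] /\ w e >]].

(* The connected component of x in the subgraph of open edges. *)
Definition open_cluster (G : sgraph) (w : edge G -> bool) (x : G) : set G :=
  [set y | exists s : seq G, path (open_adj w) x s /\ last x s = y].

(* When the vertex set is countable (in particular for connected locally
   finite G) this event belongs to the product sigma-algebra. *)
Definition percolation_event (G : sgraph) : set (config G) :=
  [set w | exists x : G, infinite_set (open_cluster w x)].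

Definition percolates (R : realType) (G : sgraph)
    (P : probability (config G) R) : Prop :=
  (0 < P (@percolation_event G))%E.

Definition Pa (R : realType) (G : sgraph) (p : R) :
    set (probability (config G) R) :=
  [set P | [/\ positively_associated P, one_independent P &
               forall e : edge G, (p%:E <= P [set w : edge G -> bool | w e])%E]].

(* For G with at least one edge this is a genuine supremum: p = 0 belongs to
   the set (all edges closed), and 1 is an upper bound. *)
Definition pa_plus (R : realType) (G : sgraph) : R :=
  sup [set p : R | exists P, Pa p P /\ ~ @percolates R G P].

Definition Zn_adj (n : nat) (x y : 'rV[int]_n) : bool :=
  \sum_(i < n) `|x 0 i - y 0 i| == 1.

Lemma Zn_adj_sym (n : nat) : symmetric (@Zn_adj n).
Proof. by move=> x y; rewrite /Zn_adj; under eq_bigr do rewrite distrC. Qed.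

Lemma Zn_adj_irr (n : nat) : irreflexive (@Zn_adj n).
Proof. by move=> x; rewrite /Zn_adj big1// => i _; rewrite subrr normr0. Qed.

Definition Zn (n : nat) : sgraph := SGraph (@Zn_adj_sym n) (@Zn_adj_irr n).

(* Main.v *)
(* Second moment method. Split the coordinates into a low and a high half and
   consider the paths from the origin that alternate a step [+e_i] or [-e_i] in
   a low coordinate with a step [+e_i] in a high coordinate. The position
   determines the time, so such paths are self-avoiding and two of them meet
   only at equal times. There are about [n * (n / 2)] choices per pair of steps,
   hence [p > sqrt 2 / n] makes the expected number of open paths grow.

   For two such paths, dropping from the second one the edges that touch the
   first (1-independence), and then restoring them at the price [1 / p] each
   (positive association), bounds the ratio
   [P (both open) / (P (first open) * P (second open))] by [(1 / p) ^ k], where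
   [k] is the number of steps at which the paths touch. Its average over pairs
   of paths is a functional of their difference, a random walk with independent
   increments. Sharing the two edges of a pair of steps has weight
   [(1 / p) ^ 2 * 2 / n ^ 2 < 1], while separating and meeting again later has
   probability [O(n ^ -3)], hence weight [O(1 / n)]. So the average stays
   bounded, and the second moment inequality bounds from below, uniformly in
   the length, the probability that some long path from the origin is open. *)
Require Import Defs.
From mathcomp Require Import all_boot all_order all_algebra.
From mathcomp Require Import all_classical all_reals all_analysis.
From mathcomp Require Import ring lra zify.

Import Order.TTheory GRing.Theory Num.Theory.
Import numFieldNormedType.Exports.

Set Implicit Arguments.
Unset Strict Implicit.
Unset Printing Implicit Defensive.

Local Open Scope classical_set_scope.
Local Open Scope ring_scope.

(** * Peak probabilities of a uniform random walk with [B] directions *)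

Section PeakBound.
Variables (R : realFieldType) (B : nat).

(* [k! / (B ^ k * c_1! ... c_B!)] for the most balanced [c_1 + ... + c_B = k],
   the largest point probability of the counts of [k] uniform steps. *)
Definition peak (k : nat) : R :=
  \prod_(i < k) (i.+1%:R / (B * (i %/ B).+1)%:R).

Hypothesis B5 : (5 <= B)%N.

Lemma peakS k : peak k.+1 = peak k * (k.+1%:R / (B * (k %/ B).+1)%:R).
Proof. by rewrite /peak big_ord_recr. Qed.

Lemma peak_ge0 k : 0 <= peak k.
Proof. by apply: prodr_ge0 => i _; rewrite divr_ge0. Qed.

Lemma peak_step_le1 k : k.+1%:R / (B * (k %/ B).+1)%:R <= 1 :> R.
Proof.
rewrite ler_pdivrMr ?mul1r ?ler_nat ?ltr0n; last by rewrite muln_gt0 andbT; lia.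
by have := ltn_ceil k (ltn_trans (isT : (0 < 4)%N) B5); rewrite mulnC.
Qed.

Lemma peak_anti k l : (k <= l)%N -> peak l <= peak k.
Proof.
elim: l => [|l IH]; first by rewrite leqn0 => /eqP ->.
rewrite leq_eqVlt => /orP[/eqP -> //|kl].
apply: le_trans (IH kl); rewrite peakS -[leRHS]mulr1.
by rewrite ler_wpM2l ?peak_ge0 // peak_step_le1.
Qed.

Lemma peak_small k : (k <= B)%N -> peak k = k`!%:R / B%:R ^+ k.
Proof.
elim: k => [|k IH] kB; first by rewrite /peak big_ord0 fact0 expr0 divr1.
rewrite peakS IH ?(ltnW kB) // divn_small // muln1 factS exprSr natrM.
have B0 : B%:R != 0 :> R by rewrite pnatr_eq0; lia.
by field; rewrite B0 expf_neq0.
Qed.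

(** Induction: adding a factor [1 - x] costs nothing, since [(1 - x) * (1 + x + S) = 1 + S - x * S -
    x ^ 2]. *)
Lemma prod_subr_le (I : Type) (s : seq I) (F : I -> R) :
  (forall i, 0 <= F i <= 1) ->
  (\prod_(i <- s) (1 - F i)) * (1 + \sum_(i <- s) F i) <= 1.
Proof.
move=> F01; elim: s => [|a s IH]; first by rewrite !big_nil addr0 mulr1.
rewrite !big_cons.
have p0 : 0 <= \prod_(i <- s) (1 - F i).
  by apply: prodr_ge0 => i _; case/andP: (F01 i) => *; rewrite subr_ge0.
have s0 : 0 <= \sum_(i <- s) F i.
  by apply: sumr_ge0 => i _; case/andP: (F01 i).
case/andP: (F01 a) => a0 a1; move: (F a) (\prod_(_ <- _) _) (\sum_(_ <- _) _) IH p0 s0 a0 a1.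
move=> x P S IH P0 S0 x0 x1.
have : P * ((1 - x) * (1 + (x + S))) <= P * (1 + S).
  by apply: ler_wpM2l => //; nra.
lra.
Qed.

Lemma peak_block l :
  peak (B * l.+1) = peak (B * l) *
    \prod_(i < B) ((B * l + i).+1%:R / (B * l.+1)%:R).
Proof.
have -> : peak (B * l.+1) = peak (B * l + B) by congr peak; lia.
rewrite /peak big_split_ord /=; congr (_ * _).
apply: eq_bigr => i _; congr (_ / (B * _.+1)%:R).
rewrite mulnC divnMDl ?divn_small ?addn0 //; lia.
Qed.

(** The factors of a block are [1 - F i] with [\sum_i F i = (B - 1) / (2 * (l + 1))]. As [5 <= B],
    this is at least [2 / (l + 1)], and [prod_subr_le] bounds the product by
    [1 / (1 + 2 / (l + 1))]. These ratios telescope to quadratic decay over blocks, which is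
    summable. *)
Lemma peak_block_le l : peak (B * l.+1) <= peak (B * l) * (l.+1%:R / l.+3%:R).
Proof.
rewrite peak_block ler_wpM2l ?peak_ge0 //.
set c : R := (B * l.+1)%:R.
have c0 : 0 < c by rewrite ltr0n muln_gt0 andbT; lia.
pose F (i : 'I_B) : R := (B.-1 - i)%:R / c.
have FE : forall i : 'I_B, (B * l + i).+1%:R / c = 1 - F i :> R.
  move=> i; rewrite /F natrB; last by have := ltn_ord i; lia.
  rewrite /F -[X in _ = X - _](divff (lt0r_neq0 c0)) -mulrBl; congr (_ / _).
  have -> : c = (B * l + B.-1).+1%:R by rewrite /c; congr (_%:R); lia.
  rewrite -!natr1 !natrD; ring.
have F01 : forall i, 0 <= F i <= 1.
  move=> i; rewrite divr_ge0 ?(ltW c0) //= ler_pdivrMr // mul1r ler_nat; nia.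
under eq_bigr => i _ do rewrite FE.
have := prod_subr_le (index_enum 'I_B) F01.
have SF : 2 / l.+1%:R <= \sum_i F i.
  have -> : \sum_i F i = (\sum_(i < B) i)%N%:R / c.
    rewrite -mulr_suml natr_sum; congr (_ / _).
    rewrite [RHS](reindex_inj rev_ord_inj) /=; apply: eq_bigr => i _; congr (_%:R); lia.
  rewrite -(big_mkord xpredT id) /= bin2_sum.
  rewrite ler_pdivlMr // mulrAC ler_pdivrMr ?ltr0n // -!natrM ler_nat.
  have : ('C(B, 2) * 2 = B * B.-1)%N by have := mul_bin_diag B 1; rewrite bin1; lia.
  by nia.
set P := \prod_(_ | _) _; set S := \sum_(_ | _) _ in SF *.
have P0 : 0 <= P by apply: prodr_ge0 => i _; case/andP: (F01 i) => *; rewrite subr_ge0.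
move=> H; rewrite ler_pdivlMr ?ltr0n //.
have L0 : 0 < l.+1%:R :> R by rewrite ltr0n.
have : P * (1 + 2 / l.+1%:R) <= 1.
  by apply: le_trans H; rewrite ler_wpM2l // lerD2l.
have -> : 1 + 2 / l.+1%:R = l.+3%:R / l.+1%:R :> R.
  have : l.+3%:R = l.+1%:R + 2 :> R by rewrite -natrD addn2.
  by move: (l.+1%:R) L0 => u u0 ->; field; rewrite lt0r_neq0.
by rewrite mulrA ler_pdivrMr // mul1r.
Qed.

Lemma peak_blocks_le l :
  peak (B * l.+1) <= peak B * (6 / (l.+2%:R * l.+3%:R)).
Proof.
elim: l => [|l IH]; first by rewrite muln1 -natrM divff ?mulr1 // pnatr_eq0.
apply: le_trans (peak_block_le _) _.
apply: le_trans (ler_wpM2r _ IH) _; first by rewrite divr_ge0.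
rewrite -mulrA ler_wpM2l ?peak_ge0 // le_eqVlt; apply/orP; left; apply/eqP.
have e2 : l.+2%:R = l%:R + 2 :> R by rewrite -natrD addn2.
have e3 : l.+3%:R = l%:R + 3 :> R by rewrite -natrD addn3.
have e4 : l.+4%:R = l%:R + 4 :> R by rewrite -natrD addn4.
have l0 : 0 <= l%:R :> R by [].
by rewrite e2 e3 e4; field; rewrite !lt0r_neq0 //; lra.
Qed.

Lemma sum_peak_mid : \sum_(3 <= k < B) peak k <= 30 / B%:R ^+ 3.
Proof.
have B0 : 0 < B%:R :> R by rewrite ltr0n; lia.
rewrite big_ltn; last lia.
have -> : 30 / B%:R ^+ 3 = 6 / B%:R ^+ 3 + 24 / B%:R ^+ 3 :> R.
  by rewrite -mulrDl -natrD.
apply: lerD; first by rewrite peak_small //; lia.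
apply: (@le_trans _ _ (\sum_(4 <= k < B) peak 4)).
  by rewrite ler_sum_nat // => k /andP[k4 _]; apply: peak_anti.
rewrite sumr_const_nat peak_small; last lia.
rewrite -[_ *+ _]mulr_natr -[4`!]/24%N exprS invfM -!mulrA ler_wpM2l //.
rewrite mulrCA -[leRHS]mulr1 ler_wpM2l ?invr_ge0 ?exprn_ge0 ?(ltW B0) //.
by rewrite mulrC ler_pdivrMr // mul1r ler_nat leq_subr.
Qed.

(** Each block of [B] terms is at most [B] times its first term, and [6 / ((l + 2) * (l + 3))]
    telescopes. *)
Lemma sum_peak_tail l :
  \sum_(B <= k < B * l.+1) peak k <= B%:R * peak B * (6 * (2^-1 - l.+2%:R^-1)).
Proof.
elim: l => [|l IH]; first by rewrite muln1 big_geq // subrr !mulr0.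
rewrite (@big_cat_nat _ _ _ (B * l.+1)) /=; [|nia|nia].
apply: (@le_trans _ _ (B%:R * peak B * (6 * (2^-1 - l.+2%:R^-1)) +
   B%:R * (peak B * (6 / (l.+2%:R * l.+3%:R))))).
  apply: lerD => //; apply: (@le_trans _ _ (\sum_(B * l.+1 <= k < B * l.+2) peak (B * l.+1))).
    by rewrite ler_sum_nat // => k /andP[k4 _]; apply: peak_anti.
  rewrite sumr_const_nat -mulnBr subSnn muln1 -[X in X <= _]mulr_natl.
  by rewrite ler_wpM2l // peak_blocks_le.
rewrite -!mulrA -mulrDr -mulrDr ler_wpM2l // ler_wpM2l ?peak_ge0 //.
rewrite -mulrDr ler_wpM2l // le_eqVlt; apply/orP; left; apply/eqP.
have e2 : l.+2%:R = l%:R + 2 :> R by rewrite -natrD addn2.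
have e3 : l.+3%:R = l%:R + 3 :> R by rewrite -natrD addn3.
have l0 : 0 <= l%:R :> R by [].
by rewrite e2 e3; field; rewrite !lt0r_neq0 //; lra.
Qed.

(** Terms below [B] give 30. The rest is at most [3 * B * peak B], and
    [peak B <= peak 4 = 24 / B ^ 4] gives 72. *)
Lemma sum_peak_le K : \sum_(3 <= k < K) peak k <= 102 / B%:R ^+ 3.
Proof.
have B0 : 0 < B%:R :> R by rewrite ltr0n; lia.
have [l Kl] : exists l, (K <= B * l.+1)%N by exists K; nia.
apply: (@le_trans _ _ (\sum_(3 <= k < B * l.+1) peak k)).
  case: (leqP 3 K) => K3; last by rewrite big_geq ?(ltnW K3) //; apply: sumr_ge0 => *; apply: peak_ge0.
  by rewrite [leRHS](@big_cat_nat _ _ _ K) //= lerDl; apply: sumr_ge0 => *; apply: peak_ge0.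
rewrite (@big_cat_nat _ _ _ B) /=; [|lia|nia].
have -> : 102 / B%:R ^+ 3 = 30 / B%:R ^+ 3 + 72 / B%:R ^+ 3 :> R.
  by rewrite -mulrDl -natrD.
apply: lerD; first exact: sum_peak_mid.
apply: le_trans (sum_peak_tail _) _.
apply: (@le_trans _ _ (B%:R * (24 / B%:R ^+ 4) * 3)); last first.
  rewrite le_eqVlt; apply/orP; left; apply/eqP; field; exact: lt0r_neq0.
apply: ler_pM => //.
- by rewrite mulr_ge0 // peak_ge0.
- by rewrite mulr_ge0 // subr_ge0 lef_pV2 ?posrE ?ltr0n // ler_nat.
- rewrite ler_wpM2l //; have <- : peak 4 = 24 / B%:R ^+ 4 by rewrite peak_small //; lia.
  by apply: peak_anti; lia.
- have : 0 <= l.+2%:R^-1 :> R by rewrite invr_ge0.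
  by move: (_^-1) => u u0; lra.
Qed.

End PeakBound.

(** * Averaging operators and the difference walk *)

Lemma sum_eq_mem (T : eqType) (s : seq T) (x : T) :
  uniq s -> (\sum_(y <- s) (y == x))%N = (x \in s).
Proof.
by move=> us; rewrite -(count_uniq_mem x us) -sumn_count sumnE big_map.
Qed.

Section Average.
Variables (R : realFieldType) (V : zmodType).
Implicit Types (s : seq V) (g : V -> R).

Definition avg s g (x : V) : R := (size s)%:R^-1 * \sum_(v <- s) g (x + v).

Definition dirac0 (x : V) : R := (x == 0)%:R.

Lemma avgC s s' g : avg s (avg s' g) = avg s' (avg s g).
Proof.
apply/funext => x; rewrite /avg.
under eq_bigr => v _ do rewrite mulr_sumr.
under [in RHS]eq_bigr => v _ do rewrite mulr_sumr.
rewrite !mulr_sumr.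
under eq_bigr => v _ do rewrite mulr_sumr.
under [in RHS]eq_bigr => v _ do rewrite mulr_sumr.
by rewrite exchange_big; do 2 (apply: eq_bigr => ? _); rewrite mulrCA addrAC.
Qed.

Lemma avgD s g h x : avg s (fun y => g y + h y) x = avg s g x + avg s h x.
Proof. by rewrite /avg big_split mulrDr. Qed.

Lemma avgZ s a g x : avg s (fun y => a * g y) x = a * avg s g x.
Proof. by rewrite /avg -mulr_sumr mulrCA. Qed.

Lemma avg_sum s I (r : seq I) (F : I -> V -> R) x :
  avg s (fun y => \sum_(i <- r) F i y) x = \sum_(i <- r) avg s (F i) x.
Proof. by rewrite /avg exchange_big mulr_sumr. Qed.

Lemma avg_le s g h x : (forall v, v \in s -> g (x + v) <= h (x + v)) ->
  avg s g x <= avg s h x.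
Proof.
move=> gh; rewrite ler_wpM2l ?invr_ge0 //.
by rewrite !big_seq; apply: ler_sum => v /gh.
Qed.

Lemma avg_cst s a x : (0 < size s)%N -> avg s (fun=> a) x = a.
Proof.
move=> s0; rewrite /avg big_const_seq count_predT iter_addr_0.
by rewrite -[X in _ * X]mulr_natl mulrA mulVf ?mul1r // pnatr_eq0 -lt0n.
Qed.

Lemma avg_ge0 s g x : (forall y, 0 <= g y) -> 0 <= avg s g x.
Proof. by move=> g0; rewrite mulr_ge0 ?invr_ge0 // sumr_ge0. Qed.

Lemma avg_sup s g M : 0 <= M -> (forall y, g y <= M) -> forall x, avg s g x <= M.
Proof.
move=> M0 gM x; case: (posnP (size s)) => [/size0nil ->|s0].
  by rewrite /avg big_nil mulr0.
by rewrite -(avg_cst M x s0); apply: avg_le => v _; apply: gM.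
Qed.

(** The probability of ending at 0 from a given point after independent steps, one uniform on each
    list of [ss]. *)
Definition convolution (ss : seq (seq V)) : V -> R := foldr avg dirac0 ss.

Lemma convolution_perm ss ss' : perm_eq ss ss' -> convolution ss = convolution ss'.
Proof.
have convrem : forall s r, s \in r -> convolution r = avg s (convolution (rem s r)).
  move=> s; elim=> //= t r IH; rewrite inE eq_sym.
  by case: eqP => [-> //|_ /= /IH ->]; rewrite avgC.
elim: ss ss' => [|s ss IH] ss' ps; first by move: ps; rewrite perm_sym => /perm_nilP ->.
have ins : s \in ss' by rewrite -(perm_mem ps) mem_head.
rewrite (convrem s _ ins) /=; congr avg; apply: IH.
by rewrite -(perm_cons s); apply: perm_trans ps (perm_to_rem ins).
Qed.

Lemma convolution_ge0 ss x : 0 <= convolution ss x.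
Proof. by elim: ss x => [|s ss IH] x //=; apply: avg_ge0. Qed.

(** Averaging preserves a uniform upper bound, so any steps may be discarded when bounding a point
    probability. *)
Lemma convolution_cat_le ss ss' M : 0 <= M -> (forall y, convolution ss' y <= M) ->
  forall x, convolution (ss ++ ss') x <= M.
Proof. by move=> M0 cM; elim: ss => //= s ss IH; apply: avg_sup. Qed.

Lemma convolution_le1 ss x : convolution ss x <= 1.
Proof.
by rewrite -[ss]cats0; apply: convolution_cat_le => // y; rewrite /= /dirac0; case: eqP.
Qed.

Lemma avg_dirac0_le s x : uniq s -> avg s dirac0 x <= (size s)%:R^-1.
Proof.
move=> us; rewrite /avg -[leRHS]mulr1 ler_wpM2l ?invr_ge0 // -natr_sum.
rewrite -[leRHS]/(1%:R) ler_nat.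
rewrite (eq_bigr (fun v => (v == - x) : nat)) ?sum_eq_mem ?leq_b1 // => v _.
by rewrite addrC addr_eq0.
Qed.

End Average.

Section Walk.
Variables (R : realFieldType) (V : zmodType) (S : bool -> seq V).
Hypothesis S0 : forall b, (0 < size (S b))%N.

Definition opp_steps (b : bool) : seq V := [seq - v | v <- S b].

Definition diff_avg (b : bool) (g : V -> R) : V -> R :=
  avg (S b) (avg (opp_steps b) g).

Fixpoint return_prob (b : bool) (m : nat) : V -> R :=
  if m is m'.+1 then diff_avg b (return_prob (~~ b) m') else @dirac0 R V.

Lemma diff_avgD b g h x :
  diff_avg b (fun y => g y + h y) x = diff_avg b g x + diff_avg b h x.
Proof. by rewrite -avgD; congr avg; apply/funext => y; rewrite avgD. Qed.

Lemma diff_avgZ b a g x : diff_avg b (fun y => a * g y) x = a * diff_avg b g x.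
Proof. by rewrite -avgZ; congr avg; apply/funext => y; rewrite avgZ. Qed.

Lemma diff_avg_sum b I (r : seq I) (F : I -> V -> R) x :
  diff_avg b (fun y => \sum_(i <- r) F i y) x = \sum_(i <- r) diff_avg b (F i) x.
Proof. by rewrite -avg_sum; congr avg; apply/funext => y; rewrite avg_sum. Qed.

Lemma diff_avg_le b g h x :
  (forall v v', v \in S b -> v' \in S b -> g (x + v - v') <= h (x + v - v')) ->
  diff_avg b g x <= diff_avg b h x.
Proof.
by move=> gh; apply: avg_le => v vS; apply: avg_le => _ /mapP[v' v'S ->]; apply: gh.
Qed.

Lemma diff_avg_cst b a x : diff_avg b (fun=> a) x = a.
Proof.
rewrite -[RHS](avg_cst a x (S0 b)); congr avg; apply/funext => y.
by rewrite avg_cst // size_map.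
Qed.

Lemma diff_avg_ge0 b g x : (forall y, 0 <= g y) -> 0 <= diff_avg b g x.
Proof. by move=> g0; do 2 (apply: avg_ge0 => ?). Qed.

Lemma return_prob_ge0 b m x : 0 <= return_prob b m x.
Proof. by elim: m b x => [|m IH] b x //=; apply: diff_avg_ge0. Qed.

(* Expectation of [z ^ k] for the difference walk started at [x], where [k] is
   the number of the first [N] steps that start or end at 0. *)
Fixpoint meet_gen (z : R) (b : bool) (N : nat) : V -> R :=
  if N is N'.+1 then fun x =>
    diff_avg b (fun y => (if (x == 0) || (y == 0) then z else 1) *
                         meet_gen z (~~ b) N' y) x
  else fun=> 1.

(* [x |-> 1 + K * (expected number of later visits to 0)] is superharmonic away
   from 0 for the walk weighted by [z] at each step touching 0. *)
Lemma meet_gen_le (z K eta : R) (Z : bool -> R) :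
  1 <= z -> (forall b, 1 <= Z b) -> (forall b, z * Z b <= K) ->
  (forall b N, diff_avg b (fun y => (y != 0)%:R *
     \sum_(m < N) return_prob (~~ b) m.+1 y) 0 <= eta) ->
  (forall b, z * (diff_avg b (@dirac0 R V) 0 * Z (~~ b) + 1 + K * eta) <= Z b) ->
  forall N b x, meet_gen z b N x <=
    if x == 0 then Z b else 1 + K * \sum_(m < N) return_prob b m.+1 x.
Proof.
move=> z1 Z1 ZK Heta HZ; have z0 : 0 <= z by lra.
have K0 : 0 <= K by apply: le_trans (ZK true); rewrite mulr_ge0 // (le_trans ler01).
elim=> [|N IH] b x /=.
  by case: eqP => // _; rewrite big_ord0 mulr0 addr0.
case: eqVneq => [->|x0] /=.
  rewrite diff_avgZ; apply: le_trans (HZ b); rewrite ler_wpM2l //.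
  pose h y := (Z (~~ b) * dirac0 R y + 1) +
     K * ((y != 0)%:R * \sum_(m < N) return_prob (~~ b) m.+1 y).
  apply: (@le_trans _ _ (diff_avg b h 0)).
    apply: diff_avg_le => v v' _ _; apply: le_trans (IH _ _) _.
    rewrite /h /dirac0; case: eqP => _; rewrite ?mulr1 ?mulr0 ?mul0r ?mul1r ?mulr0 ?add0r //.
    by rewrite addr0 lerDl.
  rewrite /h !diff_avgD !diff_avgZ diff_avg_cst mulrC lerD2l.
  by rewrite ler_wpM2l // mulrC.
(* The term of index 0 is [dirac0]: it pays for the weight of a step into 0, because
   [z * Z (~~ b) <= K]. Averaging [h] then shifts every index by one. *)
pose h y := 1 + K * (return_prob (~~ b) 0 y + \sum_(m < N) return_prob (~~ b) m.+1 y).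
apply: (@le_trans _ _ (diff_avg b h x)).
  apply: diff_avg_le => v v' _ _; move: (x + v - v') => y.
  have := IH (~~ b) y; have sr0 : 0 <= \sum_(m < N) return_prob (~~ b) m.+1 y.
    by apply: sumr_ge0 => m _; apply: return_prob_ge0.
  rewrite /h /= /dirac0; case: eqP => _ H.
    have := ler_wpM2l z0 H => H1.
    have := ZK (~~ b) => H2; have := mulr_ge0 K0 sr0 => H3.
    by rewrite mulrDr mulr1; lra.
  by rewrite mul1r add0r.
rewrite /h !diff_avgD diff_avgZ diff_avgD diff_avg_sum diff_avg_cst big_ord_recl.
by rewrite lexx.
Qed.

End Walk.

(** * Alternating lattice steps *)

Definition unit_vec (n : nat) (l : 'I_n * bool) : 'rV[int]_n :=
  (-1) ^+ l.2 *: delta_mx 0 l.1.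

Lemma unit_vecE n (l : 'I_n * bool) i :
  unit_vec l 0 i = (-1) ^+ l.2 * (i == l.1)%:R.
Proof. by rewrite !mxE eqxx. Qed.

Lemma unit_vec_inj n : injective (@unit_vec n).
Proof.
move=> [i s] [j t] /matrixP /(_ 0 i); rewrite !unit_vecE /= eqxx.
case: eqP => [<-|_]; by case: s; case: t; rewrite /= ?mulr0.
Qed.

(** Unless [l] and [m] cancel, their sum determines the unordered pair, so [l'] is one of them. *)
Lemma unit_vec_sum4 n (l m l' m' : 'I_n * bool) :
  unit_vec m + unit_vec l = unit_vec l' + unit_vec m' ->
  [|| l == l', m == l' | m == (l.1, ~~ l.2)].
Proof.
case: l m l' m' => [i s] [j t] [i' s'] [j' t'] E; rewrite !xpair_eqE /=.
have := congr1 (fun x : 'rV_n => x 0 j) E; have := congr1 (fun x : 'rV_n => x 0 i) E.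
rewrite !mxE /= !eqxx /= [i == j]eq_sym.
case: (eqVneq j i) => [->|ji]; rewrite ?eqxx.
  case: (eqVneq i i'); case: (eqVneq i j'); case: s {E}; case: t; case: s'; case: t' => //=.
rewrite eq_sym in ji.
case: (eqVneq j i') => [ji'|ji'].
  rewrite -ji' (negbTE ji) /=.
  case: (eqVneq i j'); case: (eqVneq j j'); case: s {E}; case: t; case: s'; case: t' => //=.
case: (eqVneq i i') => [ii'|ii'] /=;
  case: (eqVneq i j'); case: (eqVneq j j'); case: s {E}; case: t; case: s'; case: t' => //= *; subst => //.
all: by rewrite eqxx in ji.
Qed.

Definition high_coords (n a : nat) : seq 'I_n := [seq i : 'I_n <- enum 'I_n | (a <= i)%N].
Definition low_coords (n a : nat) : seq 'I_n := [seq i : 'I_n <- enum 'I_n | (i < a)%N].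

(* [b = true] stands for steps in the high coordinates, [b = false] for steps in
   the low ones; the letter [(i, s)] is the step [(-1) ^ s * e_i]. *)
Definition letters (n a : nat) (b : bool) : seq ('I_n * bool) :=
  if b then [seq (i, false) | i <- high_coords n a]
  else [seq (i, s) | i <- low_coords n a, s <- [:: false; true]].

Definition steps (n a : nat) (b : bool) : seq 'rV[int]_n :=
  [seq unit_vec l | l <- letters n a b].

Section Steps.
Variables (n a : nat).
Local Notation V := 'rV[int]_n.
Local Notation Is := (high_coords n a).
Local Notation e i := (unit_vec (i, false) : V).

Lemma high_coords_uniq : uniq Is.
Proof. by rewrite filter_uniq // enum_uniq. Qed.

Lemma letters_uniq b : uniq (letters n a b).
Proof.
case: b; first by rewrite map_inj_uniq ?high_coords_uniq // => i j [].
by apply: allpairs_uniq => [||[? ?] [? ?] _ _ [-> ->]] //; apply: filter_uniq; apply: enum_uniq.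
Qed.

Lemma steps_uniq b : uniq (steps n a b).
Proof. by rewrite map_inj_uniq ?letters_uniq //; apply: unit_vec_inj. Qed.

Lemma opp_steps_uniq b : uniq (opp_steps (steps n a) b).
Proof. by rewrite map_inj_uniq ?steps_uniq //; apply: oppr_inj. Qed.

Lemma size_steps b : size (steps n a b) = size (letters n a b).
Proof. by rewrite size_map. Qed.

Lemma size_letters_true : size (letters n a true) = size Is.
Proof. by rewrite size_map. Qed.

Lemma low_steps_coord v i : v \in steps n a false -> i \in Is -> v 0 i = 0.
Proof.
move=> /mapP[_ /allpairsP[[j s] /= [jl _ ->]] ->] il; rewrite unit_vecE /=.
move: jl il; rewrite !mem_filter => /andP[ja _] /andP[ia _].
by rewrite (_ : i == j = false) ?mulr0 //; apply/eqP => E; rewrite E in ia; lia.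
Qed.

Lemma coord_subr (x : V) i j : (x - e j) 0 i = x 0 i - (i == j)%:R.
Proof. by rewrite !mxE eqxx mul1r. Qed.

Lemma steps_gt0 b : (0 < size Is)%N -> (0 < size (letters n a false))%N ->
  (0 < size (steps n a b))%N.
Proof. by rewrite size_steps; case: b; rewrite ?size_letters_true. Qed.

End Steps.

(** * Point probabilities of the difference walk *)

Section ReturnBounds.
Variables (R : realFieldType) (n a : nat).
Local Notation V := 'rV[int]_n.
Local Notation Is := (high_coords n a).
Local Notation B := (size Is).
Local Notation A := (size (letters n a false)).
Local Notation e i := (unit_vec (i, false) : V).
Local Notation T' := (opp_steps (steps n a) true).
Local Notation D' := (opp_steps (steps n a) false).
Local Notation return_prob := (@return_prob R V (steps n a)).
Local Notation diff_avg := (@diff_avg R V (steps n a)).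

Hypothesis B5 : (5 <= B)%N.
Hypothesis A0 : (0 < A)%N.

Let Bn0 : B%:R != 0 :> R. Proof. by rewrite pnatr_eq0; lia. Qed.
Let Bp : 0 < B%:R :> R. Proof. by rewrite lt0r Bn0 /=. Qed.

Lemma avg_high g (x : V) : avg T' g x = B%:R^-1 * \sum_(i <- Is) g (x - e i) :> R.
Proof. by rewrite /avg /opp_steps !size_map !big_map. Qed.

Section Single.
Variables (g : V -> R) (M : R).
Hypothesis g0 : forall x, 0 <= g x.
Hypothesis gM : forall x, g x <= M.
Hypothesis g_supp : forall x, g x != 0 -> forall i, i \in Is -> x 0 i = 0.
Local Notation f := (fun k => iter k (avg T') g).

(* Exchangeability: coordinate [i] counts the steps along [e_i], and each of the
   [k] steps plays the same part in that count. *)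
Lemma iter_avg_coord k (x : V) i : i \in Is ->
  (x 0 i)%:~R * f k x = k%:R / B%:R * f k.-1 (x - e i).
Proof.
move=> iI; elim: k x => [|k IH] x /=.
  rewrite !mul0r; have [-> | /g_supp ->] := eqVneq (g x) 0; by rewrite ?mulr0 ?mul0r.
rewrite avg_high mulrCA mulr_sumr.
have E j : (x 0 i)%:~R * f k (x - e j) =
    k%:R / B%:R * f k.-1 (x - e i - e j) + (j == i)%:R * f k (x - e i).
  have [->|ji] := eqVneq j i.
    rewrite -IH -mulrDl; congr (_ * _).
    by rewrite coord_subr eqxx intrB subrK.
  by rewrite mul0r addr0 addrAC -IH coord_subr eq_sym (negbTE ji) subr0.
under eq_bigr => j _ do rewrite E.
rewrite big_split /= -mulr_sumr -mulr_suml.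
have -> : \sum_(j <- Is) (j == i)%:R = 1 :> R.
  by rewrite -natr_sum sum_eq_mem ?high_coords_uniq // iI.
rewrite mul1r mulrDr mulrCA; case: k {IH E} => [|k]; first by rewrite !mul0r add0r mul1r.
rewrite -avg_high -[k.+2%:R]natr1 /=; move: (avg _ _ _) => u; ring.
Qed.

Lemma iter_avg_ge0 k x : 0 <= f k x.
Proof. by elim: k x => //= k IH x; apply: avg_ge0. Qed.

Lemma iter_avg_supp k (x : V) : f k x != 0 -> \sum_(i <- Is) x 0 i = k%:Z.
Proof.
elim: k x => [|k IH] x /=; first by move=> /g_supp gx; rewrite big_seq big1.
rewrite avg_high mulf_eq0 negb_or => /andP[_].
rewrite psumr_neq0; last by move=> *; apply: iter_avg_ge0.
case/hasP => i iI /= fi; have := IH (x - e i); rewrite gt_eqF // => /(_ isT).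
rewrite (eq_bigr (fun j : (ordinal n) => x 0 j - (j == i)%:R)); last by move=> j _; rewrite coord_subr.
rewrite big_split /= sumrN.
have -> : \sum_(j <- Is) (j == i)%:R = 1 :> int.
  by rewrite -natr_sum sum_eq_mem ?high_coords_uniq // iI.
by move=> H; rewrite -[LHS](subrK 1) H; lia.
Qed.

(** The [k + 1] high steps are spread over [B] coordinates, so some coordinate of [x] is at least
    [k %/ B + 1]. Dividing [iter_avg_coord] by it yields exactly one further factor of [peak]. *)
Lemma iter_avg_peak k x : f k x <= peak R B k * M.
Proof.
elim: k x => [|k IH] x; first by rewrite /peak big_ord0 mul1r.
have M0 : 0 <= M by apply: le_trans (gM 0).
have [->|fx] := eqVneq (f k.+1 x) 0; first by rewrite mulr_ge0 ?peak_ge0.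
have [i iI xi] : exists2 i, i \in Is & ((k %/ B).+1%:Z <= x 0 i).
  have [/hasP[i iI xi]|/hasPn hn] := boolP (has (fun i => (k %/ B).+1%:Z <= x 0 i) Is).
    by exists i.
  have := iter_avg_supp fx; have : \sum_(i <- Is) x 0 i <= \sum_(i <- Is) (k %/ B)%:Z.
    by rewrite !big_seq; apply: ler_sum => i /hn; lia.
  rewrite big_const_seq count_predT iter_addr_0 -mulr_natr => H E; rewrite E in H.
  have := leq_trunc_div k B; lia.
have := iter_avg_coord k.+1 x iI; move: (f k.+1 x) => F /=.
have c0 : 0 < (k %/ B).+1%:R :> R by [].
move=> E; have F1 : k.+1%:R / B%:R * f k (x - e i) <= k.+1%:R / B%:R * (peak R B k * M).
  by rewrite ler_wpM2l ?divr_ge0.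
have [Fneg|F0] := leP F 0; first by rewrite (le_trans Fneg) // mulr_ge0 ?peak_ge0.
have : (k %/ B).+1%:R * F <= (x 0 i)%:~R * F.
  by rewrite ler_wpM2r ?(ltW F0) //; move: xi; rewrite -(ler_int R).
rewrite E peakS natrM invfM => /le_trans /(_ F1) H.
rewrite -(ler_pM2l c0); apply: le_trans H _; rewrite le_eqVlt; apply/orP; left; apply/eqP.
by move: (_.+1%:R) c0 => c c0; field; rewrite Bn0 lt0r_neq0.
Qed.

End Single.

Definition high_count (b : bool) (m : nat) : nat := ((b + m)./2)%N.
Definition low_count (b : bool) (m : nat) : nat := ((~~ b + m)./2)%N.

Fixpoint ret_steps (b : bool) (m : nat) : seq (seq V) :=
  if m is m'.+1 then steps n a b :: opp_steps (steps n a) b :: ret_steps (~~ b) m'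
  else [::].

Lemma return_prob_convolution b m : return_prob b m = convolution R (ret_steps b m).
Proof. by elim: m b => //= m IH b; rewrite IH. Qed.

(** [ss] collects the steps of the first walk; those of the second are sorted into high and low
    ones. *)
Lemma ret_steps_perm b m : exists ss, perm_eq (ret_steps b m)
  (ss ++ nseq (high_count b m) T' ++ nseq (low_count b m) D').
Proof.
elim: m b => [|m IH] b; first by exists [::]; case: b.
have [ss ps] := IH (~~ b); exists (steps n a b :: ss).
rewrite /= perm_cons; apply: perm_trans (_ : perm_eq _ (opp_steps (steps n a) b :: _)) _.
  by rewrite perm_cons; exact: ps.
rewrite -cat1s perm_catCA perm_cat2l cat1s.
by case: b {ps IH} => //; rewrite -[_ :: _]cat1s perm_catCA perm_cat2l /low_count /high_count /=.
Qed.

Lemma convolution_nseq_cat k s ss : convolution R (nseq k s ++ ss) = iter k (avg s) (convolution R ss) :> (V -> R).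
Proof. by elim: k => //= k ->. Qed.

Lemma convolution_low_supp j (x : V) : convolution R (nseq j D') x != 0 ->
  forall i, i \in Is -> x 0 i = 0.
Proof.
elim: j x => [|j IH] x /=; first by rewrite /dirac0; case: (eqVneq x 0) => [-> *|_]; rewrite ?mxE ?eqxx.
rewrite mulf_eq0 negb_or => /andP[_]; rewrite psumr_neq0; last by move=> *; apply: convolution_ge0.
case/hasP => _ /mapP[v vS ->] /= h i iI; move: h; rewrite lt0r => /andP[/IH /(_ i iI) H _].
by move: H; rewrite !mxE (low_steps_coord vS iI) subr0.
Qed.

(** The first walk is averaged out, so only the randomness of the second is used: its high steps
    give [peak], and a single low step, if there is one, gives [1 / A]. *)
Lemma return_prob_le b m x :
  return_prob b m x <= peak R B (high_count b m) * (if (0 < low_count b m)%N then A%:R^-1 else 1).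
Proof.
have [ss ps] := ret_steps_perm b m; rewrite return_prob_convolution (convolution_perm R ps).
have M0 : 0 <= (if (0 < low_count b m)%N then A%:R^-1 else 1) :> R by case: ifP; rewrite ?invr_ge0.
apply: convolution_cat_le => [|y]; first by rewrite mulr_ge0 ?peak_ge0.
rewrite convolution_nseq_cat; apply: iter_avg_peak => [z|z|z].
- exact: convolution_ge0.
- case: (low_count b m) => [|j]; first exact: convolution_le1.
  rewrite [nseq _ _](_ : _ = nseq j D' ++ [:: D']); last by rewrite -(nseqD j 1) addn1.
  apply: convolution_cat_le => [|w]; first by rewrite invr_ge0.
  rewrite -size_steps -(size_map -%R).
  by apply: avg_dirac0_le; apply: opp_steps_uniq.
- exact: convolution_low_supp.
Qed.

End ReturnBounds.

(** * Meeting again after a separation *)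

Section Revisit.
Variables (R : realFieldType) (n a : nat).
Local Notation V := 'rV[int]_n.
Local Notation Is := (high_coords n a).
Local Notation B := (size Is).
Local Notation A := (size (letters n a false)).
Local Notation return_prob := (@return_prob R V (steps n a)).
Local Notation diff_avg := (@diff_avg R V (steps n a)).

Hypothesis B5 : (5 <= B)%N.
Hypothesis A0 : (0 < A)%N.

(** High steps all have sign plus, so the high coordinate raised by [v] can only be cancelled by
    [v' = v]. *)
Lemma high_diff v v' (x : V) : (forall i, i \in Is -> x 0 i = 0) ->
  v \in steps n a true -> v' \in steps n a true -> v - v' + x = 0 -> v = v' /\ x = 0.
Proof.
move=> x0 vS v'S E.
have vv' : v = v'.
  move: vS v'S E => /mapP[_ /mapP[i iI ->] ->] /mapP[_ /mapP[j jI ->] ->] E.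
  have := congr1 (fun x : 'rV_n => x 0 i) E.
  by rewrite !mxE /= (x0 i iI) eqxx !mul1r; case: eqP => [->|].
by split=> //; move: E; rewrite vv' subrr add0r.
Qed.

Lemma low_diff_coord v v' i : v \in steps n a false -> v' \in steps n a false ->
  i \in Is -> (v - v') 0 i = 0.
Proof.
by move=> vS v'S iI; rewrite !mxE (low_steps_coord vS iI) (low_steps_coord v'S iI) subr0.
Qed.

Lemma return_prob1E b x : return_prob b 1 x = (size (letters n a b))%:R^-1 ^+ 2 *
  \sum_(v <- steps n a b) \sum_(v' <- steps n a b) (x + v - v' == 0)%:R.
Proof.
rewrite /= /diff_avg /avg !size_map -mulr_sumr mulrA -expr2.
congr (_ * _); apply: eq_bigr => v _; rewrite big_map.
by apply: eq_bigr.
Qed.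

Lemma return_prob1_other b v v' : v \in steps n a (~~ b) -> v' \in steps n a (~~ b) ->
  v != v' -> return_prob b 1 (v - v') = 0.
Proof.
move=> vS v'S vv'; rewrite return_prob1E big_seq big1 ?mulr0 // => w wS.
rewrite big_seq big1 // => w' w'S; case: eqP => // E; case/eqP: vv'.
case: b vS v'S wS w'S => vS v'S wS w'S.
  have [] := high_diff (fun i => low_diff_coord vS v'S) wS w'S; last by move=> _ /subr0_eq.
  by rewrite -E -[RHS]addrA addrC.
by have [] := high_diff (fun i => low_diff_coord wS w'S) vS v'S; rewrite ?addrA.
Qed.

(* Two distinct opposite corners of a square are joined by only two 2-step
   paths, which is what makes this return rare. *)
Lemma return_prob_low_high_low v v' :
  v \in steps n a false -> v' \in steps n a false -> v != v' ->
  return_prob true 2 (v - v') <= 2 / (A%:R ^+ 2 * B%:R).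
Proof.
move=> vS v'S vv'.
(* Averaging operators commute, so the low step may be taken first. *)
have -> : return_prob true 2 (v - v') = diff_avg false (return_prob true 1) (v - v').
  pose ss b := [:: steps n a b; opp_steps (steps n a) b].
  exact: (congr1 (fun f => f _) (convolution_perm R (permEl (perm_catC (ss true) (ss false))))).
(* After low steps only, the high coordinates of the difference vanish, so by [high_diff] a high
   step ends at 0 only from 0. *)
apply: (@le_trans _ _ (diff_avg false (fun y => B%:R^-1 * (y == 0)%:R) (v - v'))).
  apply: diff_avg_le => w w' wS w'S; case: eqP => [->|y0]; rewrite ?mulr1 ?mulr0.
    apply: le_trans (return_prob_le _ B5 A0 _ _ _) _; rewrite /high_count /low_count /= mulr1.
    by rewrite peak_small ?fact_small ?expr1 ?mul1r //; lia.
  rewrite return_prob1E big_seq big1 ?mulr0 // => u uS; rewrite big_seq big1 // => u' u'S.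
  case: eqP => // E; case: y0.
  have [||_ //] := @high_diff u u' (v - v' + w - w') _ uS u'S; last by rewrite addrC addrA; exact: E.
  move=> i iI; rewrite -addrA mxE.
  by rewrite (low_diff_coord vS v'S iI) (low_diff_coord wS w'S iI).
have -> : 2 / (A%:R ^+ 2 * B%:R) = B%:R^-1 * ((A%:R ^+ 2)^-1 * 2) :> R.
  by rewrite invfM; ring.
rewrite diff_avgZ.
rewrite ler_wpM2l ?invr_ge0 // -[diff_avg _ _ _]/(return_prob false 1 (v - v')) return_prob1E exprVn.
rewrite ler_wpM2l ?invr_ge0 ?exprn_ge0 //.
move: vS v'S vv' => /mapP[l lS ->] /mapP[l' l'S ->]; rewrite (inj_eq (@unit_vec_inj n)) => ll'.
(* By [unit_vec_sum4] the first walk must step by [l'] or by the opposite of [l], and the step of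
   the second walk is then forced. *)
rewrite big_map; apply: (@le_trans _ _ (\sum_(m <- letters n a false)
    ((m == l') + (m == (l.1, ~~ l.2)))%:R)).
  apply: ler_sum => m _.
  have [hm|hm] := boolP ((m == l') || (m == (l.1, ~~ l.2))).
    apply: (@le_trans _ _ 1); last by rewrite ler1n; move: hm; do 2 case: eqP.
    rewrite -natr_sum -[leRHS]/(1%:R) ler_nat.
    rewrite (eq_bigr (fun v => (v == unit_vec l - unit_vec l' + unit_vec m) : nat)); last first.
      by move=> ? _; rewrite subr_eq0 eq_sym.
    by rewrite sum_eq_mem ?steps_uniq ?leq_b1.
  rewrite big_map big1 // => m' _; case: eqP => // E.
  have : unit_vec m + unit_vec l = unit_vec l' + unit_vec m'.
    by rewrite -(subr0_eq E) addrA [unit_vec l' + _]addrC subrK addrC.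
  move=> /unit_vec_sum4; rewrite (negbTE ll') /=; by rewrite (negbTE hm).
rewrite -natr_sum ler_nat big_split -[2%N]/(1 + 1)%N; apply: leq_add.
all: by rewrite sum_eq_mem ?leq_b1; last exact: letters_uniq.
Qed.

Lemma peak1 : peak R B 1 = B%:R^-1.
Proof. by rewrite peak_small ?expr1 ?mul1r //; lia. Qed.

Lemma peak2 : peak R B 2 = 2 / B%:R ^+ 2.
Proof. by rewrite peak_small //; lia. Qed.

(* Bounds the probability that two walks which separate with their first step are
   together again [m + 1] steps later. *)
Definition revisit_bound (m : nat) : R :=
  match m with
  | 0 => 0
  | 1 => 2 / (A%:R ^+ 2 * B%:R) + 2 / (B%:R ^+ 2 * A%:R)
  | 2 | 3 => 2 / (B%:R ^+ 2 * A%:R)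
  | m => peak R B (m.+2)./2
  end.

Lemma revisit_bound_ge0 m : 0 <= revisit_bound m.
Proof.
case: m => [|[|[|[|m]]]] //=; rewrite ?peak_ge0 ?addr_ge0 ?divr_ge0 ?mulr_ge0 ?exprn_ge0 //.
Qed.

(** Forgetting that the walks separated is affordable except for [m = 0], and for low-high-low steps
    at [m = 1], whose single high step is too weak. There the geometry of [return_prob1_other] and
    [return_prob_low_high_low] is used. *)
Lemma revisit_le b m :
  diff_avg b (fun y => (y != 0)%:R * return_prob (~~ b) m.+1 y) 0 <= revisit_bound m.
Proof.
have drop : diff_avg b (fun y => (y != 0)%:R * return_prob (~~ b) m.+1 y) 0 <= return_prob b m.+2 0.
  apply: diff_avg_le => v v' _ _; rewrite -[leRHS]mul1r ler_wpM2r ?return_prob_ge0 //.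
  by case: eqP.
have S0 c : (0 < size (steps n a c))%N by apply: steps_gt0 => //; lia.
have A1 : A%:R^-1 <= 1 :> R by rewrite invf_le1 ?ler1n // ltr0n.
have long : (2 <= high_count b m.+2)%N -> (0 < low_count b m.+2)%N ->
    return_prob b m.+2 0 <= 2 / (B%:R ^+ 2 * A%:R).
  move=> h2 l0; apply: le_trans (return_prob_le _ B5 A0 _ _ _) _; rewrite l0 invfM mulrA.
  by rewrite -peak2 ler_wpM2r ?invr_ge0 // peak_anti.
case: m drop long => [|[|[|[|m]]]] drop long.
- rewrite -[leRHS](@diff_avg_cst R _ _ S0 b 0 0).
  apply: diff_avg_le => v v' vS v'S; rewrite add0r subr_eq0.
  by case: eqVneq => [|vv']; rewrite ?mul0r // return_prob1_other ?mulr0 // negbK.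
- case: b drop long => drop long.
    by apply: le_trans drop _; apply: le_trans (long _ _) _ => //; rewrite lerDr divr_ge0 // mulr_ge0 ?exprn_ge0.
  apply: (@le_trans _ _ (2 / (A%:R ^+ 2 * B%:R))); last by rewrite lerDl divr_ge0 // mulr_ge0 ?exprn_ge0.
  rewrite -[leRHS](@diff_avg_cst R _ _ S0 false _ 0).
  apply: diff_avg_le => v v' vS v'S; rewrite add0r subr_eq0.
  case: eqVneq => [|vv']; first by rewrite mul0r divr_ge0 // mulr_ge0 ?exprn_ge0.
  by rewrite mul1r; apply: return_prob_low_high_low.
- by apply: le_trans drop _; apply: long; case: b.
- by apply: le_trans drop _; apply: long; case: b.
- apply: le_trans drop _; apply: le_trans (return_prob_le _ B5 A0 _ _ _) _.
  rewrite -[leRHS]mulr1; apply: ler_pM; rewrite ?peak_ge0 //; first by case: ifP; rewrite ?invr_ge0.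
    by apply: peak_anti => //; rewrite /high_count; case: b {long}; lia.
  by case: ifP.
Qed.

Lemma revisit_sum_le b N :
  diff_avg b (fun y => (y != 0)%:R * \sum_(m < N) return_prob (~~ b) m.+1 y) 0 <=
  2 / (A%:R ^+ 2 * B%:R) + 6 / (B%:R ^+ 2 * A%:R) + 204 / B%:R ^+ 3.
Proof.
under [X in diff_avg _ X]funext => y do rewrite mulr_sumr.
rewrite diff_avg_sum; apply: (@le_trans _ _ (\sum_(m < N) revisit_bound m)).
  by apply: ler_sum => m _; apply: revisit_le.
rewrite -(big_mkord xpredT revisit_bound).
(* From [m = 4] on, consecutive indices share the same [peak] term; the range is extended so that
   they pair up exactly, whence [204 = 2 * 102]. *)
apply: (@le_trans _ _ (\sum_(0 <= m < (4 + N.*2)) revisit_bound m)).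
  rewrite [leRHS](@big_cat_nat _ _ _ N) //=; last lia.
  by rewrite lerDl sumr_ge0 // => *; apply: revisit_bound_ge0.
rewrite (@big_cat_nat _ _ _ 4) //=; apply: lerD.
  rewrite big_nat_recl // !big_nat_recl // big_geq //= addr0 add0r -!addrA lerD2l.
  by rewrite -!mulrDl -!natrD.
have tail : \sum_(4 <= m < 4 + N.*2) revisit_bound m = 2 * \sum_(3 <= k < 3 + N) peak R B k.
  elim: N => [|N IH]; first by rewrite !big_geq ?mulr0.
  have recr (F : nat -> R) k l : (k <= l)%N ->
    \sum_(k <= i < l.+1) F i = \sum_(k <= i < l) F i + F l by exact: big_nat_recr.
  rewrite doubleS !addnS (recr _ 4%N (4 + N.*2).+1%N); last by rewrite leqW ?leq_addr.
  rewrite (recr _ 4%N (4 + N.*2)%N) ?leq_addr // (recr _ 3%N (3 + N)%N) ?leq_addr // IH.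
  rewrite mulrDr -addrA; congr (_ + _).
  rewrite !addSn !add0n /= !doubleK uphalf_double; ring.
rewrite tail; have -> : 204 / B%:R ^+ 3 = 2 * (102 / B%:R ^+ 3) :> R by rewrite mulrA -natrM.
by rewrite ler_wpM2l //; apply: sum_peak_le.
Qed.

End Revisit.

(** * Pairs of alternating words *)

Section Words.
Variables (n a : nat).
Local Notation V := 'rV[int]_n.

Fixpoint words (b : bool) (N : nat) : seq (seq ('I_n * bool)) :=
  if N is N'.+1 then [seq l :: w | l <- letters n a b, w <- words (~~ b) N']
  else [:: [::]].

Fixpoint touch (x : V) (w w' : seq ('I_n * bool)) : nat :=
  match w, w' with
  | l :: w1, l' :: w1' => let y := x + unit_vec l - unit_vec l' in
      (((x == 0%R) || (y == 0%R)) + touch y w1 w1')%N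
  | _, _ => 0
  end.

Lemma size_words_gt0 b N : (0 < size (high_coords n a))%N ->
  (0 < size (letters n a false))%N -> (0 < size (words b N))%N.
Proof.
move=> h l; elim: N b => //= N IH b; rewrite size_allpairs muln_gt0 IH andbT.
by rewrite -size_steps steps_gt0.
Qed.

Lemma words_size b N w : w \in words b N -> size w = N.
Proof.
elim: N b w => [|N IH] b w /=; first by rewrite inE => /eqP ->.
by move=> /allpairsP[[l u] /= [_ /IH <- ->]].
Qed.

(** Links counting to probability: the letters of a uniform word are independent and uniform, and
    [touch] depends on the pair only through the difference walk. *)
Lemma sum_touch (R : realFieldType) (z : R) b N x :
  (0 < size (high_coords n a))%N -> (0 < size (letters n a false))%N ->
  \sum_(w <- words b N) \sum_(w' <- words b N) z ^+ touch x w w' =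
  (size (words b N))%:R ^+ 2 * meet_gen (steps n a) z b N x.
Proof.
move=> h l; elim: N b x => [|N IH] b x; first by rewrite !big_seq1 expr1n mulr1.
have sb : (size (letters n a b))%:R != 0 :> R.
  by rewrite pnatr_eq0 -lt0n -size_steps steps_gt0.
pose F m m' : R := let y := x + unit_vec m - unit_vec m' in
  (if (x == 0) || (y == 0) then z else 1) * meet_gen (steps n a) z (~~ b) N y.
have -> : meet_gen (steps n a) z b N.+1 x = (size (letters n a b))%:R^-1 ^+ 2 *
    \sum_(m <- letters n a b) \sum_(m' <- letters n a b) F m m'.
  rewrite /= /diff_avg /avg !size_map big_map expr2 -[RHS]mulrA; congr (_ * _).
  by rewrite mulr_sumr; apply: eq_bigr => m _; rewrite !big_map.
rewrite [words _ _]/= size_allpairs natrM exprMn exprVn mulrACA divff ?expf_neq0 // mul1r.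
rewrite big_allpairs_dep mulr_sumr; apply: eq_bigr => m _.
under eq_bigr => w _ do rewrite big_allpairs_dep.
rewrite exchange_big mulr_sumr; apply: eq_bigr => m' _ /=.
rewrite /F mulrCA -IH mulr_sumr; apply: eq_bigr => w _.
by rewrite mulr_sumr; apply: eq_bigr => w' _; rewrite exprD; case: (_ || _).
Qed.

End Words.

(** * Boundedness of the generating function *)

Section MeetBound.
Variables (R : realFieldType) (n a : nat).
Local Notation Is := (high_coords n a).
Local Notation B := ((size Is)%:R : R).
Local Notation A := ((size (letters n a false))%:R : R).
Hypothesis B5 : (5 <= size Is)%N.
Hypothesis A0 : (0 < size (letters n a false))%N.

(** [z / A * (z / B)] is the weight of staying together for a low and a high step; below 1 it makes
    the linear recursion for [Q] solvable. The other hypothesis makes the contribution of later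
    meetings at most 1. *)
Lemma meet_gen_bounded (z : R) :
  1 <= z -> z / A * (z / B) < 1 ->
  z ^+ 2 * (2 / (A ^+ 2 * B) + 6 / (B ^+ 2 * A) + 204 / B ^+ 3) *
    (4 + 2 * (z / A) + 2 * (z / B)) <= 1 - z / A * (z / B) ->
  exists C, forall N, meet_gen (steps n a) z false N 0 <= C.
Proof.
move=> z1; set H := _ + _ / B ^+ 3; set x := z / A; set y := z / B => xy1 zH.
have z0 : 0 < z by lra.
have Ap : 0 < A by rewrite ltr0n. have Bp : 0 < B by rewrite ltr0n; lia.
have x0 : 0 <= x by rewrite divr_ge0 ?(ltW z0).
have y0 : 0 <= y by rewrite divr_ge0 ?(ltW z0).
have d0 : 0 < 1 - x * y by lra.
(* The solution of the recursion [Qrec]; its constant 2 is the 1 of a separation plus at most 1 for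
   meeting again ([QH]). *)
pose Q (b : bool) := (2 + 2 * (if b then y else x)) / (1 - x * y).
have Q2 b : 2 <= Q b.
  rewrite /Q ler_pdivlMr //; have := mulr_ge0 x0 y0; case: b; lra.
have Qrec b : (if b then y else x) * Q (~~ b) + 2 = Q b.
  by rewrite /Q; case: b => /=; field; rewrite lt0r_neq0.
have QH : z ^+ 2 * (Q false + Q true) * H <= 1.
  rewrite /Q -mulrDl mulrAC mulrA ler_pdivrMr // mul1r.
  by apply: le_trans zH; rewrite le_eqVlt; apply/orP; left; apply/eqP; ring.
exists (z * Q false) => N.
have := @meet_gen_le R _ (steps n a) _ z (z ^+ 2 * (Q false + Q true)) H (fun b => z * Q b)
  z1 _ _ _ _ N false 0; rewrite eqxx; apply.
- by move=> b; apply: steps_gt0 => //; lia.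
- by move=> b; have := Q2 b => ?; nra.
- move=> b; rewrite expr2 -mulrA ler_wpM2l ?(ltW z0) // ler_wpM2l ?(ltW z0) //.
  by have := Q2 true; have := Q2 false; case: b; lra.
- by move=> b M; apply: revisit_sum_le.
move=> b; rewrite ler_wpM2l ?(ltW z0) // -(Qrec b).
have D : diff_avg (steps n a) b (@dirac0 R _) 0 <= (if b then B else A)^-1.
  rewrite -[diff_avg _ _ _ _]/(return_prob R (steps n a) b 1 0).
  apply: le_trans (return_prob_le R B5 A0 _ _ _) _; case: b; rewrite /high_count /low_count /=.
    by rewrite mulr1 peak1.
  by rewrite /peak big_ord0 mul1r.
rewrite -addrA; apply: lerD; last lra.
rewrite mulrA; apply: ler_wpM2r; first by have := Q2 (~~ b); lra.
by rewrite mulrC; case: b D => D; rewrite /x /y ler_wpM2l // ltW.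
Qed.

End MeetBound.

Lemma size_high_coords n a : size (high_coords n a) = (n - a)%N.
Proof.
rewrite size_filter -(count_map val (fun i => (a <= i)%N)) val_enum_ord.
elim: n => [|n IH]; first by [].
rewrite -addn1 iotaD count_cat IH /= add0n addn0; case: leqP; lia.
Qed.

Lemma size_low_letters n a : (a <= n)%N -> size (letters n a false) = (a.*2)%N.
Proof.
move=> an; rewrite size_allpairs muln2; congr (_.*2).
rewrite size_filter -(count_map val (fun i => (i < a)%N)) val_enum_ord.
have -> : n = (a + (n - a))%N by lia.
rewrite iotaD count_cat add0n.
rewrite (@eq_in_count _ _ xpredT); last by move=> i; rewrite mem_iota /= => ->.
rewrite count_predT size_iota (@eq_in_count _ _ xpred0); first by rewrite count_pred0 addn0.
by move=> i; rewrite mem_iota => /andP[ai _]; rewrite ltnNge ai.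
Qed.

Lemma meet_gen_half_bounded (R : rcfType) (n : nat) (e : R) :
  0 < e <= 1 -> 300 ^+ 2 <= n%:R * e ->
  exists C, forall N, meet_gen (steps n n./2) (n%:R / (Num.sqrt 2 * (1 + e))) false N 0 <= C.
Proof.
move=> /andP[e0 e1] ne.
have nR : 300 ^+ 2 <= n%:R :> R by apply: le_trans ne _; rewrite ler_piMr.
have nn : (100 <= n)%N by rewrite -(ler_nat R); apply: le_trans nR; rewrite expr2; lra.
have [s0 s2] : 0 < Num.sqrt 2 :> R /\ Num.sqrt 2 ^+ 2 = 2 :> R.
  by rewrite sqrtr_gt0 sqr_sqrtr.
have s1 : 1 <= Num.sqrt 2 :> R by rewrite -[leLHS]sqrtr1 ler_wsqrtr // ler1n.
have s3 : Num.sqrt 2 <= 2 :> R by nra.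
set s := Num.sqrt 2 in s0 s2 s1 s3 *.
have se0 : 0 < s * (1 + e) by nra.
set z := _ / _; have zE : z ^+ 2 = n%:R ^+ 2 / (2 * (1 + e) ^+ 2).
  by rewrite /z expr_div_n exprMn s2.
have z1 : 1 <= z by rewrite /z ler_pdivlMr // mul1r; nra.
have zn : z <= n%:R by rewrite /z ler_pdivrMr // ler_peMr //; nra.
have an : (n./2 <= n)%N by clear; lia.
(* Here [A] is [2 * (n %/ 2)] and [B] is [n - n %/ 2]: [2 * A * B] equals [n ^ 2] for even [n] and
   [n ^ 2 - 1] for odd [n]. *)
suff key (A B : R) : n%:R / 2 <= A -> n%:R / 2 <= B -> n%:R ^+ 2 - 1 <= 2 * A * B ->
    z / A * (z / B) <= 1 - e / 3 /\
    z ^+ 2 * (2 / (A ^+ 2 * B) + 6 / (B ^+ 2 * A) + 204 / B ^+ 3) *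
      (4 + 2 * (z / A) + 2 * (z / B)) <= e / 3.
  have [|||H1 H2] := key (n./2.*2)%:R (n - n./2)%:R.
  - by rewrite ler_pdivrMr // -natrM ler_nat; clear -nn; lia.
  - by rewrite ler_pdivrMr // -natrM ler_nat; clear -nn; lia.
  - rewrite lerBlDr -natrX -!natrM natr1 ler_nat; clear -nn.
    by have := odd_double_half n; case: odd => /=; nia.
  apply: meet_gen_bounded; rewrite ?size_high_coords ?size_low_letters //.
  - by clear -nn; lia.
  - by clear -nn; lia.
  - by apply: le_lt_trans H1 _; lra.
  - by apply: le_trans H2 _; lra.
move: (n%:R : R) nR ne zE zn => m nR ne zE zn A2 B2 AB.
have m0 : 0 < m by apply: lt_le_trans nR; apply: exprn_gt0; rewrite ltr0n.
have m1 : 1 <= m by rewrite (le_trans _ nR) // exprn_ege1 // ler1n.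
have A0 : 0 < A by apply: lt_le_trans A2; rewrite divr_gt0.
have B0 : 0 < B by apply: lt_le_trans B2; rewrite divr_gt0.
have z0 : 0 <= z by lra.
have e2 : 0 < 1 + e by lra.
split.
  rewrite mulrACA -invfM -expr2 ler_pdivrMr ?mulr_gt0 // zE.
  rewrite ler_pdivrMr ?mulr_gt0 ?exprn_gt0 //.
  have q0 : 0 <= (1 - e / 3) * (1 + e) ^+ 2 by rewrite mulr_ge0 ?exprn_ge0 //; lra.
  have q1 : 1 + e <= (1 - e / 3) * (1 + e) ^+ 2 by nra.
  have : (1 - e / 3) * (1 + e) ^+ 2 * (m ^+ 2 - 1) <= (1 - e / 3) * (1 + e) ^+ 2 * (2 * A * B).
    by rewrite ler_wpM2l.
  have : (1 + e) * (m ^+ 2 - 1) <= (1 - e / 3) * (1 + e) ^+ 2 * (m ^+ 2 - 1).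
    by rewrite ler_wpM2r //; nra.
  have : 2 <= m * e by apply: le_trans ne; rewrite expr2; lra.
  nra.
set t := 2 / m.
have t0 : 0 < t by rewrite divr_gt0.
have mt : m * t = 2 by rewrite /t mulrCA divff ?mulr1 // lt0r_neq0.
have At : 0 <= A^-1 <= t.
  by rewrite invr_ge0 (ltW A0) /= /t -invf_div lef_pV2 ?posrE ?divr_gt0.
have Bt : 0 <= B^-1 <= t.
  by rewrite invr_ge0 (ltW B0) /= /t -invf_div lef_pV2 ?posrE ?divr_gt0.
rewrite [(A ^+ 2 * B)^-1]invfM [(B ^+ 2 * A)^-1]invfM -!exprVn.
move: A^-1 B^-1 At Bt => u v /andP[u0 ut] /andP[v0 vt].
have uv : u ^+ 2 * v <= t ^+ 3 by rewrite [t ^+ 3]exprSr ler_pM ?exprn_ge0 // lerXn2r // nnegrE ltW.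
have vu : v ^+ 2 * u <= t ^+ 3 by rewrite [t ^+ 3]exprSr ler_pM ?exprn_ge0 // lerXn2r // nnegrE ltW.
have vv : v ^+ 3 <= t ^+ 3 by rewrite lerXn2r // nnegrE ltW.
have zu : z * u <= 2 by rewrite -mt ler_pM.
have zv : z * v <= 2 by rewrite -mt ler_pM.
(* [212 = 2 + 6 + 204], and [12 = 4 + 2 * 2 + 2 * 2] by [zu] and [zv]. *)
apply: (@le_trans _ _ (m ^+ 2 * (212 * t ^+ 3) * 12)).
  have zu0 : 0 <= z * u by rewrite mulr_ge0.
  have zv0 : 0 <= z * v by rewrite mulr_ge0.
  have p0 : 0 <= u ^+ 2 * v by rewrite mulr_ge0 ?exprn_ge0.
  have q0 : 0 <= v ^+ 2 * u by rewrite mulr_ge0 ?exprn_ge0.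
  have r0 : 0 <= v ^+ 3 by rewrite exprn_ge0.
  have zm : z ^+ 2 <= m ^+ 2 by rewrite lerXn2r ?nnegrE // ltW.
  apply: ler_pM; [by apply: mulr_ge0; [exact: exprn_ge0|lra]|lra| |lra].
  by apply: ler_pM => //; [exact: exprn_ge0|lra|lra].
have -> : m ^+ 2 * (212 * t ^+ 3) * 12 = 212 * (m * t) ^+ 2 * 12 * t by ring.
(* What remains is [3 * 212 * 4 * 12 * 2 = 61056 <= m * e], which [300 ^ 2] covers. *)
rewrite mt /t mulrA ler_pdivrMr // [leRHS]mulrAC ler_pdivlMr // [e * m]mulrC.
by apply: le_trans ne; rewrite !expr2; lra.
Qed.

(** * Second moment inequality and open paths *)

Section SecondMoment.
Context d (T : measurableType d) (R : realType) (P : probability T R).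
Local Notation pr X := (fine (P X)).

Lemma prD (A B : set T) : measurable A -> measurable B ->
  pr A = pr (A `&` B) + pr (A `\` B).
Proof.
move=> mA mB; have PA := measureDI P mA mB.
have f1 := fin_num_measure P _ (measurableI A B mA mB).
have f2 := fin_num_measure P _ (measurableD mA mB).
by rewrite addrC -fineD // -PA.
Qed.

(* The right-hand side is the expectation of the square of [s + \sum c_i 1_(A_i)]
   over [B]; the induction splits [B] along the [A_i] instead of integrating. *)
Lemma pr_quadratic_ge0 (I : Type) (A : I -> set T) (c : I -> R) (r : seq I) (s : R) (B : set T) :
  (forall i, measurable (A i)) -> measurable B ->
  0 <= s ^+ 2 * pr B + 2 * s * (\sum_(i <- r) c i * pr (A i `&` B)) +
       \sum_(i <- r) \sum_(j <- r) c i * c j * pr (A i `&` A j `&` B).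
Proof.
move=> mA; elim: r s B => [|k r IH] s B mB.
  by rewrite !big_nil mulr0 !addr0 mulr_ge0 ?sqr_ge0 // fine_ge0.
have mI := IH (s + c k) (B `&` A k) (measurableI _ _ mB (mA k)).
have mD := IH s (B `\` A k) (measurableD mB (mA k)).
apply: le_trans (addr_ge0 mI mD) _; rewrite le_eqVlt; apply/orP; left; apply/eqP.
rewrite !big_cons.
rewrite [X in _ = _ + (_ + X)](eq_bigr (fun i => c i * c k * pr (A i `&` A k `&` B) +
  \sum_(j <- r) c i * c j * pr (A i `&` A j `&` B))); last by move=> i _; rewrite big_cons.
rewrite [X in _ = _ + (_ + X)]big_split /=.
rewrite (prD mB (mA k)).
have -> : \sum_(i <- r) c i * pr (A i `&` B) = \sum_(i <- r) c i * pr (A i `&` (B `&` A k)) +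
    \sum_(i <- r) c i * pr (A i `&` (B `\` A k)).
  rewrite -big_split; apply: eq_bigr => i _ /=; rewrite -mulrDr; congr (_ * _).
  rewrite (prD (measurableI _ _ (mA i) mB) (mA k)) setIA setIDA //.
have -> : \sum_(i <- r) \sum_(j <- r) c i * c j * pr (A i `&` A j `&` B) =
    \sum_(i <- r) \sum_(j <- r) c i * c j * pr (A i `&` A j `&` (B `&` A k)) +
    \sum_(i <- r) \sum_(j <- r) c i * c j * pr (A i `&` A j `&` (B `\` A k)).
  rewrite -big_split; apply: eq_bigr => i _; rewrite -big_split; apply: eq_bigr => j _ /=.
  rewrite -mulrDr; congr (_ * _).
  rewrite (prD (measurableI _ _ (measurableI _ _ (mA i) (mA j)) mB) (mA k)) setIA setIDA //.
have -> : \sum_(i <- r) c k * c i * pr (A k `&` A i `&` B) =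
    c k * \sum_(i <- r) c i * pr (A i `&` (B `&` A k)).
  rewrite mulr_sumr; apply: eq_bigr => i _; rewrite mulrA; congr (_ * pr _).
  by rewrite -setIA setICA [A k `&` B]setIC.
have -> : \sum_(i <- r) c i * c k * pr (A i `&` A k `&` B) =
    c k * \sum_(i <- r) c i * pr (A i `&` (B `&` A k)).
  rewrite mulr_sumr; apply: eq_bigr => i _; rewrite mulrA [c i * _]mulrC; congr (_ * pr _).
  by rewrite -setIA [A k `&` B]setIC.
by rewrite setIid [A k `&` B]setIC; ring.
Qed.

Lemma second_moment (I : eqType) (A : I -> set T) (r : seq I) (U : set T) (C : R) :
  (forall i, measurable (A i)) -> measurable U -> (0 < size r)%N -> 0 < C ->
  (forall i, i \in r -> 0 < pr (A i)) -> (forall i, i \in r -> A i `<=` U) ->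
  \sum_(i <- r) \sum_(j <- r) pr (A i `&` A j) / (pr (A i) * pr (A j)) <=
    C * (size r)%:R ^+ 2 ->
  C^-1 <= pr U.
Proof.
move=> mA mU r0 C0 A0 AU H; set M : R := (size r)%:R in H *.
have M0 : 0 < M by rewrite ltr0n.
(* With weights [1 / pr (A i)] the sum has expectation [M] on [U]. The shift [- (C * M)] minimises
   the quadratic when [pr U = 1 / C]. *)
have := pr_quadratic_ge0 (fun i => (pr (A i))^-1) r (- (C * M)) mA mU.
have -> : \sum_(i <- r) (pr (A i))^-1 * pr (A i `&` U) = M.
  rewrite big_seq (eq_bigr (fun=> 1)) => [|i ir].
    by rewrite -big_seq big_const_seq count_predT iter_addr_0.
  by rewrite (setIidl (AU i ir)) mulVf // lt0r_neq0 // A0.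
have -> : \sum_(i <- r) \sum_(j <- r) (pr (A i))^-1 * (pr (A j))^-1 * pr (A i `&` A j `&` U) =
   \sum_(i <- r) \sum_(j <- r) pr (A i `&` A j) / (pr (A i) * pr (A j)).
  rewrite big_seq [RHS]big_seq; apply: eq_bigr => i ir; apply: eq_bigr => j _.
  rewrite invfM mulrC; congr (pr _ * _); apply: setIidl.
  by apply: subset_trans (AU i ir); exact: subIsetl.
move=> Q; rewrite -(ler_pM2l (mulr_gt0 C0 (mulr_gt0 C0 (exprn_gt0 2 M0)))).
have -> : C * (C * M ^+ 2) / C = C * M ^+ 2 by field; exact: lt0r_neq0.
move: Q H; move: (pr U) (\sum_(i <- r) _) => u S Q H; nra.
Qed.

End SecondMoment.

(** * Consequences of 1-independence and positive association *)

Section OpenEvents.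
Variables (R : realType) (G : sgraph) (P : probability (config G) R).

Definition open_on (f : nat -> edge G) (r : seq nat) : set (config G) :=
  [set w : edge G -> bool | all (fun t => w (f t)) r].

Lemma open_on_cons f t r : open_on f (t :: r) = [set w : edge G -> bool | w (f t)] `&` open_on f r.
Proof. by apply/seteqP; split => w /= /andP. Qed.

Lemma open_on_cat f r s : open_on f (r ++ s) = open_on f r `&` open_on f s.
Proof. by apply/seteqP; split => w /=; rewrite /open_on /= all_cat => /andP. Qed.

Lemma open_on_status (F : set (edge G)) f r : (forall t, t \in r -> F (f t)) ->
  status_algebra F (open_on f r).
Proof.
elim: r => [|t r IH] Ff.
  by have := @measurableT _ (g_sigma_algebraType (cylinders F)); congr measurable; apply/seteqP.
rewrite open_on_cons; apply: (@measurableI _ (g_sigma_algebraType (cylinders F))).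
  by apply: sub_sigma_algebra; exists (f t) => //; apply: Ff; rewrite mem_head.
by apply: IH => u ur; apply: Ff; rewrite inE ur orbT.
Qed.

Lemma measurable_open_on f r : measurable (open_on f r).
Proof. exact: open_on_status. Qed.

Lemma open_on_increasing f r : increasing_event (open_on f r).
Proof.
split; first exact: measurable_open_on.
by move=> w w' ww' /= /allP wr; apply/allP => t /wr /ww'.
Qed.

Lemma open_on_pos_assoc (p : R) f r s : 0 <= p -> Pa p P ->
  ((p ^+ size r)%:E * P (open_on f s) <= P (open_on f (r ++ s)))%E.
Proof.
move=> p0 [PA _ Pp]; elim: r => [|t r IH]; first by rewrite expr0 mul1e.
rewrite cat_cons open_on_cons exprS EFinM -muleA.
have inc : increasing_event [set w : edge G -> bool | w (f t)].
  have := open_on_increasing f [:: t]; congr increasing_event.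
  by rewrite open_on_cons; apply/seteqP; split => w // [].
apply: le_trans (PA _ _ inc (open_on_increasing _ _)).
apply: lee_pmul => //; rewrite ?lee_fin //.
by rewrite mule_ge0 // lee_fin exprn_ge0.
Qed.

Lemma open_on_indep (p : R) f g r s : Pa p P ->
  (forall t u, t \in r -> u \in s -> sval (f t) `&` sval (g u) = set0) ->
  P (open_on f r `&` open_on g s) = (P (open_on f r) * P (open_on g s))%E.
Proof.
move=> [_ IP _] fg.
have E : endpoints (f @` [set` r]) `&` endpoints (g @` [set` s]) = set0.
  apply/seteqP; split => // x [[_ [t tr <-] xt] [_ [u us <-] xu]].
  have : (sval (f t) `&` sval (g u)) x by [].
  by rewrite fg.
apply: (IP (f @` [set` r]) (g @` [set` s])) => //.
- apply/seteqP; split => // e [[t tr <-] [u us gf]].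
  (* Every edge has an endpoint, so edge sets without common endpoints are disjoint. *)
  have [x xe] : exists x, sval (f t) x by case: (f t) => ? /= [x [y [_ ->]]]; exists x; left.
  have : (sval (f t) `&` sval (g u)) x by split => //; rewrite gf.
  by rewrite fg.
- by apply: open_on_status => t tr; exists t.
- by apply: open_on_status => t tr; exists t.
Qed.

(** The edges of [g] at untouched times are independent of all of [f]; [open_on_pos_assoc] restores
    the touched ones at a factor [p] each. *)
Lemma open_on_pair_le (p : R) f g r (touched : pred nat) : 0 <= p -> Pa p P ->
  (forall t u, t \in r -> u \in r -> ~~ touched u -> sval (f t) `&` sval (g u) = set0) ->
  p ^+ count touched r * fine (P (open_on f r `&` open_on g r)) <=
  fine (P (open_on f r)) * fine (P (open_on g r)).
Proof.
move=> p0 Pp fg.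
have mO h s := measurable_open_on h s.
set s1 := [seq u <- r | ~~ touched u]; set s2 := [seq u <- r | touched u].
have Og : open_on g r = open_on g (s2 ++ s1).
  apply/seteqP; split => w /allP wr; apply/allP => u.
    by move=> us; apply: wr; move: us; rewrite mem_cat !mem_filter -andb_orl; case/andP.
  by move=> ur; apply: wr; rewrite mem_cat !mem_filter ur !andbT orbN.
have H1 : (P (open_on f r `&` open_on g r) <= P (open_on f r) * P (open_on g s1))%E.
  rewrite -(@open_on_indep p) //; last first.
    by move=> t u tr; rewrite mem_filter => /andP[]; move=> *; apply: fg.
  rewrite Og open_on_cat; apply: le_measure; rewrite ?inE.
  - by do 2 (apply: measurableI => //).
  - exact: measurableI.
  - by apply: setIS; exact: subIsetr.
have := open_on_pos_assoc g s2 s1 p0 Pp; rewrite -Og size_filter => H2.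
rewrite -lee_fin 2!EFinM !fineK ?fin_num_measure //; last exact: measurableI.
apply: (@le_trans _ _ ((p ^+ count touched r)%:E * (P (open_on f r) * P (open_on g s1)))%E).
  by rewrite lee_wpmul2l // lee_fin exprn_ge0.
by rewrite muleCA lee_wpmul2l.
Qed.

End OpenEvents.

(** * Alternating paths in the lattice *)

Section Paths.
Variables (n a : nat) (l0 : 'I_n * bool).
Local Notation V := 'rV[int]_n.

Lemma Zn_adj_unit_vec (x : V) l : Zn_adj x (x + unit_vec l).
Proof.
rewrite /Zn_adj (bigD1 l.1) //= big1 => [|i il].
  by rewrite mxE unit_vecE eqxx mulr1 opprD addrA subrr add0r normrN normrX normrN1 expr1n.
by rewrite mxE unit_vecE (negbTE il) mulr0 addr0 subrr normr0.
Qed.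

Definition step_edge (x : Zn n) (l : 'I_n * bool) : edge (Zn n) :=
  exist _ [set x; (x : V) + unit_vec l]
    (ex_intro _ x (ex_intro _ ((x : V) + unit_vec l) (conj (Zn_adj_unit_vec x l) erefl))).

(** The default letter [l0] makes positions total in [t]; past the end of [w] they carry no meaning.
    The free start [x] serves the induction in [count_touch]. *)
Definition path_pos (x : V) (w : seq ('I_n * bool)) (t : nat) : V :=
  x + \sum_(i < t) unit_vec (nth l0 w i).

Definition path_edge (w : seq ('I_n * bool)) (t : nat) : edge (Zn n) :=
  step_edge (path_pos 0 w t) (nth l0 w t).

Lemma path_posS x w t : path_pos x w t.+1 = path_pos x w t + unit_vec (nth l0 w t).
Proof. by rewrite /path_pos big_ord_recr addrA. Qed.

Lemma path_pos0 x w : path_pos x w 0 = x.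
Proof. by rewrite /path_pos big_ord0 addr0. Qed.

Lemma path_pos_cons x l w t : path_pos x (l :: w) t.+1 = path_pos (x + unit_vec l) w t.
Proof. by rewrite /path_pos big_ord_recl /= addrA. Qed.

Lemma eq_path_pos x w w' t : (forall i, (i < t)%N -> nth l0 w i = nth l0 w' i) ->
  path_pos x w t = path_pos x w' t.
Proof. by move=> ww'; congr (_ + _); apply: eq_bigr => i _; rewrite ww'. Qed.

Lemma path_edgeE w t : sval (path_edge w t) = [set path_pos 0 w t; path_pos 0 w t.+1].
Proof. by rewrite path_posS. Qed.

Lemma words_nth b N w t : w \in words n a b N -> (t < N)%N ->
  nth l0 w t \in letters n a (b (+) odd t).
Proof.
elim: N b w t => [|N IH] b w t //= /allpairsP[[l u] /= [lL uW ->]].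
by case: t => [_|t /(IH _ _ _ uW)] /=; rewrite ?addbF // addNb addbN.
Qed.

Definition height (x : V) : int := \sum_(i < n | (a <= i)%N) x 0 i.
Definition coord_sum (x : V) : int := \sum_(i < n) x 0 i.

(* Time can be read off the position on an alternating path from the origin:
   low steps change the parity, high steps raise the height. *)
Definition clock (x : V) : int := height x * 2 + (coord_sum x %% 2)%Z.

Lemma height_step x b l : l \in letters n a b -> height (x + unit_vec l) = height x + b%:Z.
Proof.
move=> lL; rewrite /height; under eq_bigr => i _ do rewrite mxE unit_vecE.
rewrite big_split /=; congr (_ + _); case: b lL.
  move=> /mapP[j]; rewrite mem_filter => /andP[aj _] -> /=.
  rewrite (bigD1 j) //= eqxx big1 ?addr0 // => i /andP[_ ij].
  by rewrite (negbTE ij) mulr0.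
move=> /allpairsP[[j s] /=]; rewrite mem_filter => -[/andP[ja _] _ ->].
rewrite big1 // => i ai /=; rewrite (_ : i == j = false) ?mulr0 //.
by apply/eqP => E; rewrite E in ai; lia.
Qed.

Lemma coord_sum_step x l : ((coord_sum (x + unit_vec l)) %% 2 = (coord_sum x + 1) %% 2)%Z.
Proof.
rewrite /coord_sum; under eq_bigr => i _ do rewrite mxE unit_vecE.
rewrite big_split /= [X in (_ + X)%R](bigD1 l.1) //= eqxx mulr1 [X in (_ + (_ + X))%R]big1 ?addr0.
  by move: (\sum_(i < n) _) => S; case: l.2; rewrite /= ?expr0 ?expr1 //; lia.
by move=> i il; rewrite (negbTE il) mulr0.
Qed.

Lemma clock_path_pos N w t : w \in words n a false N -> (t <= N)%N ->
  clock (path_pos 0 w t) = t%:Z.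
Proof.
move=> wW; suff H : (t <= N)%N -> height (path_pos 0 w t) = (t./2)%:Z /\
    (coord_sum (path_pos 0 w t) %% 2)%Z = (odd t)%:Z.
  by move=> /H[h c]; rewrite /clock h c; have := odd_double_half t; lia.
elim: t => [_|t IH tN].
  rewrite path_pos0 /height /coord_sum !big1 // => i _; by rewrite mxE.
have [h c] := IH (ltnW tN); have := words_nth wW tN => /= tL.
rewrite path_posS (height_step _ tL) coord_sum_step h; split; last first.
  by move: c; rewrite /=; case: (odd t) => /=; lia.
by rewrite /= uphalf_half; lia.
Qed.

(** By [clock], a common vertex is visited by both paths at the same time, which is [t] or [t + 1].
    Hence the condition involves only the time on the second path. *)
Lemma path_edges_disjoint N w w' s t : w \in words n a false N -> w' \in words n a false N ->
  (s < N)%N -> (t < N)%N ->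
  ~~ ((path_pos 0 w t == path_pos 0 w' t) || (path_pos 0 w t.+1 == path_pos 0 w' t.+1)) ->
  sval (path_edge w s) `&` sval (path_edge w' t) = set0.
Proof.
move=> wW w'W sN tN /norP[/eqP n1 /eqP n2].
have same i j : (i <= N)%N -> (j <= N)%N -> path_pos 0 w i = path_pos 0 w' j -> i = j.
  move=> iN jN E; have := clock_path_pos wW iN; rewrite E (clock_path_pos w'W jN); lia.
rewrite !path_edgeE; apply/seteqP; split => // x [[] -> []] E.
- by have st := same _ _ (ltnW sN) (ltnW tN) E; rewrite st in E.
- by have st := same _ _ (ltnW sN) tN E; rewrite st in E.
- by have st := same _ _ sN (ltnW tN) E; rewrite st in E.
- by have st := same _ _ sN tN E; rewrite st in E.
Qed.

Lemma count_touch N x x' w w' : size w = N -> size w' = N ->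
  count (fun t => (path_pos x w t == path_pos x' w' t) || (path_pos x w t.+1 == path_pos x' w' t.+1)) (iota 0 N) =
  touch (x - x') w w'.
Proof.
elim: N x x' w w' => [|N IH] x x' [|l w] [|l' w'] //= [sw] [sw'].
rewrite (iotaDl 1 0) count_map -[in RHS]subr_eq0 !path_posS !path_pos0 /=.
have E : x - x' + unit_vec l - unit_vec l' = x + unit_vec l - (x' + unit_vec l').
  by rewrite opprD [RHS]addrACA addrA.
rewrite E -(IH _ _ _ _ sw sw') !subr_eq0; congr (_ + _)%N.
by apply: eq_count => t /=; rewrite !add1n !path_pos_cons.
Qed.

End Paths.

(** * Percolation *)

Section PercolationMeasurable.
Variables (G : sgraph).
Hypothesis countG : countable [set: G].

Lemma measurable_open_adj (x y : G) :
  measurable ([set w : edge G -> bool | open_adj w x y] : set (config G)).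
Proof.
have [[e exy]|ne] := pselect (exists e : edge G, sval e = [set x; y]).
  rewrite (_ : [set w | _] = open_on (fun=> e) [:: 0%N]); first exact: measurable_open_on.
  apply/seteqP; split => w; rewrite /open_on /= andbT.
    move=> /asboolP[e' [e'xy we']]; suff -> : e = e' by [].
    by case: e e' exy e'xy {we'} => [u hu] [v hv] /= uE vE; apply: eq_exist; rewrite uE vE.
  by move=> we; apply/asboolP; exists e.
rewrite (_ : [set w | _] = set0); first exact: measurable0.
by apply/seteqP; split => // w /= /asboolP[e [exy _]]; apply: ne; exists e.
Qed.

Lemma measurable_path (x : G) (s : seq G) :
  measurable ([set w : edge G -> bool | path (open_adj w) x s] : set (config G)).
Proof.
elim: s x => [|y s IH] x /=; first by rewrite (_ : [set w | _] = setT) //; apply/seteqP.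
rewrite (_ : [set w | _] = [set w : edge G -> bool | open_adj w x y] `&`
   [set w : edge G -> bool | path (open_adj w) y s]).
  by apply: measurableI => //; exact: measurable_open_adj.
by apply/seteqP; split => w /= /andP.
Qed.

Lemma countable_seqT : countable [set: seq G].
Proof.
have [f finj] := countable_injP _ countG.
apply/countable_injP; exists (fun s => pickle (map f s)) => s t _ _.
move=> /(pcan_inj pickleK); apply: inj_map => x y; apply: finj; exact: in_setT.
Qed.

Lemma measurable_open_cluster (x y : G) :
  measurable ([set w : edge G -> bool | open_cluster w x y] : set (config G)).
Proof.
rewrite (_ : [set w | _] = \bigcup_(s : seq G)
   [set w : edge G -> bool | path (open_adj w) x s /\ last x s = y]); last first.
  by apply/seteqP; split => w /= [s]; [exists s|move=> _ ?; exists s].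
apply: countable_bigcupT_measurable => [|s]; first exact: countable_seqT.
have [E|E] := pselect (last x s = y).
  rewrite (_ : [set w | _] = [set w : edge G -> bool | path (open_adj w) x s]).
    exact: measurable_path.
  by apply/seteqP; split => w /= => [[]|].
by rewrite (_ : [set w | _] = set0) //; apply/seteqP; split => w // [].
Qed.

(** A cluster is infinite when no finite list of vertices exhausts it, which turns the event into
    countable unions and complements. Measurability permits the comparison of probabilities in
    [percolates_of_bound]. *)
Lemma measurable_percolation : measurable (@percolation_event G).
Proof.
rewrite (_ : @percolation_event G = \bigcup_(x : G) ~` \bigcup_(s : seq G)
   ~` \bigcup_(y : G) [set w : edge G -> bool | open_cluster w x y /\ y \notin s]); last first.
  apply/seteqP; split => w [x].
    move=> ix; exists x => // -[s _ /= H]; apply: ix; apply: (sub_finite_set _ (finite_seq s)).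
    move=> y xy; apply: contrapT => /negP ys; apply: H; exists y => //.
  move=> _ H; exists x => /finite_seqP[s E]; apply: H; exists s => // -[y _ [xy]].
  by move=> /negP; apply; move: xy; rewrite E.
apply: countable_bigcupT_measurable => // x; apply: measurableC.
apply: countable_bigcupT_measurable => [|s]; first exact: countable_seqT.
apply: measurableC; apply: countable_bigcupT_measurable => // y.
have [ys|ys] := boolP (y \in s).
  by rewrite (_ : [set w | _] = set0) //; apply/seteqP; split => w // [].
rewrite (_ : [set w | _] = [set w : edge G -> bool | open_cluster w x y]).
  exact: measurable_open_cluster.
by apply/seteqP; split => w /= => [[]|].
Qed.

End PercolationMeasurable.

(** * From long open paths to an infinite cluster *)

Section Survival.
Variables (R : realType) (n a : nat) (l0 : 'I_n * bool).
Variable P : probability (config (Zn n)) R.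
Local Notation pr X := (fine (P X)).
Local Notation ws N := (words n a false N).
Local Notation V := 'rV[int]_n.
Local Notation path_edge := (path_edge l0).
Local Notation path_pos := (path_pos l0).
Hypothesis high0 : (0 < size (high_coords n a))%N.
Hypothesis low0 : (0 < size (letters n a false))%N.

Definition path_open (N : nat) (w : seq ('I_n * bool)) : set (config (Zn n)) :=
  open_on (path_edge w) (iota 0 N).

Definition survive (N : nat) : set (config (Zn n)) :=
  \bigcup_(w in [set` ws N]) path_open N w.

Lemma measurable_survive N : measurable (survive N).
Proof.
apply: fin_bigcup_measurable; first exact: finite_seq.
by move=> w _; apply: measurable_open_on.
Qed.

Lemma words_take b N w : w \in words n a b N.+1 -> take N w \in words n a b N.
Proof.
elim: N b w => [|N IH] b w; first by rewrite take0 mem_head.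
move=> /allpairsP[[l u] /= [lL /IH uW ->]] /=.
by apply/allpairsP; exists (l, take N u).
Qed.

Lemma survive_anti : nonincreasing_seq survive.
Proof.
apply/nonincreasing_seqP => N; rewrite subsetEset => om [w wW /allP ow].
exists (take N w); first exact: words_take.
apply/allP => t tN; have /ow : t \in iota 0 N.+1 by move: tN; rewrite !mem_iota; lia.
have tN' : (t < N)%N by move: tN; rewrite mem_iota.
congr (om _); apply: eq_exist; rewrite /=.
have E : path_pos 0 w t = path_pos 0 (take N w) t.
  by apply: eq_path_pos => i it; rewrite nth_take // (ltn_trans it).
by rewrite E nth_take.
Qed.

Lemma path_open_cluster N w om t : path_open N w om -> (t <= N)%N ->
  open_cluster om (0 : Zn n) (path_pos 0 w t).
Proof.
move=> /allP ow; elim: t => [_|t IH tN]; first by exists [::]; rewrite path_pos0.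
have [s [ps ls]] := IH (ltnW tN); exists (rcons s (path_pos 0 w t.+1)).
rewrite rcons_path last_rcons ps ls; split=> //=; apply/asboolP.
by exists (path_edge w t); rewrite path_edgeE; split=> //; apply: ow; rewrite mem_iota.
Qed.

(** For every [N] the cluster of the origin contains a vertex with [clock] equal to [N], so its
    image under [clock] is infinite. *)
Lemma survive_percolation : \bigcap_N survive N `<=` @percolation_event (Zn n).
Proof.
move=> om H; exists (0 : Zn n) => fin.
apply: infinite_nat; apply: (sub_finite_set _ (finite_image (fun x : V => absz (clock a x)) fin)).
move=> N _; have [w wW ow] := H N I; exists (path_pos 0 w N).
  exact: path_open_cluster ow _.
by rewrite (clock_path_pos l0 wW (leqnn N)).
Qed.

Lemma path_open_gt0 (p : R) N w : 0 < p -> Pa p P -> 0 < pr (path_open N w).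
Proof.
move=> p0 Pp; have := open_on_pos_assoc (path_edge w) (iota 0 N) [::] (ltW p0) Pp.
rewrite cats0 (_ : open_on _ [::] = setT); last by apply/seteqP.
rewrite probability_setT mule1 size_iota -[P _]fineK ?fin_num_measure //; last first.
  exact: measurable_open_on.
by rewrite lee_fin; apply: lt_le_trans; rewrite exprn_gt0.
Qed.

Lemma survive_ge (p C : R) N : 0 < p -> 0 < C -> Pa p P ->
  meet_gen (steps n a) p^-1 false N 0 <= C -> C^-1 <= pr (survive N).
Proof.
move=> p0 C0 Pp HC.
apply: (@second_moment _ _ _ _ _ (path_open N) (ws N)) => //.
- by move=> w; apply: measurable_open_on.
- exact: measurable_survive.
- exact: size_words_gt0.
- by move=> w _; apply: path_open_gt0 Pp.
- by move=> w wW; apply: (@bigcup_sup _ _ w).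
apply: (@le_trans _ _ (\sum_(w <- ws N) \sum_(w' <- ws N) p^-1 ^+ touch 0 w w')).
  rewrite !big_seq; apply: ler_sum => w wW; rewrite !big_seq; apply: ler_sum => w' w'W.
  have := @open_on_pair_le R _ P p (path_edge w) (path_edge w') (iota 0 N)
    (fun t => (path_pos 0 w t == path_pos 0 w' t) || (path_pos 0 w t.+1 == path_pos 0 w' t.+1)) (ltW p0) Pp.
  rewrite count_touch ?(words_size wW) ?(words_size w'W) // subr0 => H.
  rewrite ler_pdivrMr ?mulr_gt0 ?(path_open_gt0 _ _ p0 Pp) //.
  rewrite exprVn mulrC ler_pdivlMr ?exprn_gt0 // mulrC; apply: H => s t.
  by rewrite !mem_iota => sN tN; apply: path_edges_disjoint wW w'W _ _.
by rewrite sum_touch // mulrC ler_wpM2r ?exprn_ge0.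
Qed.

(** Continuity from above along the decreasing events [survive N], each of probability at least
    [1 / C]. *)
Lemma percolates_of_bound (p C : R) : 0 < p -> Pa p P ->
  (forall N, meet_gen (steps n a) p^-1 false N 0 <= C) -> @percolates R (Zn n) P.
Proof.
move=> p0 Pp HC; have C0 : 0 < C by apply: lt_le_trans (HC 0%N).
have mcap : measurable (\bigcap_N survive N).
  by apply: bigcapT_measurable => N; apply: measurable_survive.
rewrite /percolates; apply: (@lt_le_trans _ _ (C^-1)%:E); first by rewrite lte_fin invr_gt0.
apply: (@le_trans _ _ (P (\bigcap_N survive N))); last first.
  apply: le_measure; rewrite ?inE //; last exact: survive_percolation.
  apply: measurable_percolation; exact: countableP.
have cv := nonincreasing_cvg_mu (mu := P) (F := survive) _ measurable_survive mcap survive_anti.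
have {}cv : P (survive N) @[N --> \oo] --> P (\bigcap_N survive N).
  by apply: cv; rewrite ltey_eq fin_num_measure //; apply: measurable_survive.
rewrite -(cvg_lim _ cv) //; apply: lime_ge; first by apply/cvg_ex; eexists; exact: cv.
near=> N; rewrite -[leRHS]fineK ?fin_num_measure //; last exact: measurable_survive.
by rewrite lee_fin; apply: survive_ge Pp (HC N).
Unshelve. all: by end_near.
Qed.

End Survival.

(** * The asymptotic bound on the critical probability *)

Lemma Pa_anti (R : realType) (G : sgraph) (p q : R) (P : probability (config G) R) :
  q <= p -> Pa p P -> Pa q P.
Proof.
move=> qp [PA IP Pp]; split=> // e.
by apply: le_trans (Pp e); rewrite lee_fin.
Qed.

Lemma pa_plus_le (R : realType) (n : nat) (e : R) :
  0 < e <= 1 -> 300 ^+ 2 <= n%:R * e ->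
  pa_plus R (Zn n) <= Num.sqrt 2 / n%:R * (1 + e).
Proof.
move=> e01 ne; have /andP[e0 e1] := e01.
have nR : 300 ^+ 2 <= n%:R :> R by apply: le_trans ne _; rewrite ler_piMr.
have nn : (100 <= n)%N by rewrite -(ler_nat R); apply: le_trans nR; rewrite expr2; lra.
have s0 : 0 < Num.sqrt 2 :> R by rewrite sqrtr_gt0.
have n0 : 0 < n%:R :> R by apply: lt_le_trans nR; apply: exprn_gt0; rewrite ltr0n.
have e2 : 0 < 1 + e by lra.
have b0 : 0 < Num.sqrt 2 / n%:R * (1 + e) :> R by rewrite !mulr_gt0 ?invr_gt0.
rewrite /pa_plus; set S := [set p | _].
(* [ge_sup] asks for a nonempty set; on the empty one [sup] takes the default value 0. *)
have [->|/set0P S0] := eqVneq S set0; first by rewrite sup0 ltW.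
apply: ge_sup => // p [P [Pp nperc]]; rewrite leNgt; apply/negP => bp; apply: nperc.
have [C HC] := meet_gen_half_bounded e01 ne.
apply: (@percolates_of_bound R n n./2 (Ordinal (leq_trans (isT : (0 < 100)%N) nn), false)
  P _ _ _ C b0 (Pa_anti (ltW bp) Pp)).
- by rewrite size_high_coords; clear -nn; lia.
- by rewrite size_low_letters; clear -nn; lia.
by move=> N; rewrite mulrAC invf_div; apply: HC.
Qed.

Theorem corollary1 (R : realType) :
  exists eps : nat -> R,
    eps n @[n --> \oo] --> (0 : R) /\
    forall n : nat, (0 < n)%N ->
      pa_plus R (Zn n) <= Num.sqrt 2 / n%:R * (1 + eps n).
Proof.
have s0 : 0 < Num.sqrt 2 :> R by rewrite sqrtr_gt0.
(* The least nonnegative error for which the inequality holds; [pa_plus_le] puts it below any [e] in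
   [(0, 1]] once [300 ^ 2 <= n * e]. *)
exists (fun n => Num.max 0 (pa_plus R (Zn n) * n%:R / Num.sqrt 2 - 1)); split; last first.
  move=> n n0; rewrite mulrAC ler_pdivlMr ?ltr0n // mulrC -[leRHS]mulrC -ler_pdivrMr //.
  by rewrite -lerBlDl le_max [n%:R * _]mulrC lexx orbT.
apply/cvgrPdist_le => d d0; pose e := Num.min d 1.
have e0 : 0 < e by rewrite lt_min d0 ltr01.
near=> n.
have ne : 300 ^+ 2 <= n%:R * e.
  rewrite -ler_pdivrMr //; near: n; exact: nbhs_infty_ger.
have n0 : 0 < n%:R :> R.
  by rewrite -(pmulr_lgt0 _ e0); apply: lt_le_trans ne; apply: exprn_gt0; rewrite ltr0n.
rewrite sub0r normrN ger0_norm; last by rewrite le_max lexx.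
rewrite ge_max ltW //= lerBlDl ler_pdivrMr // -ler_pdivlMr //.
have e01 : 0 < e <= 1 by rewrite e0 ge_min lexx orbT.
apply: le_trans (pa_plus_le e01 ne) _.
rewrite -[leRHS]mulrA [leRHS]mulrC ler_wpM2l ?divr_ge0 ?(ltW s0) ?(ltW n0) // lerD2l.
by rewrite ge_min lexx.
Unshelve. all: by end_near.
Qed.
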